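(* Let $\varphi:\mathbb{D}\to\mathbb{D}$ be a parabolic holomorphic self-map of zero hyperbolic step with Koenigs function $h_\varphi$, and let $\psi\in\mathcal{Z}_{\forall}(\varphi)$. Suppose that $$h\circ\varphi=h+c_1,\qquad h\circ\psi=h+c_2,$$ for some holomorphic function $h:\mathbb{D}\to\mathbb{C}$ and some $c_1,c_2\in\mathbb{C}$ with $|c_1|^2+|c_2|^2\neq0$. If the simultaneous linearization coefficient $c_{\varphi,\psi}$ is not a rational real number, i.e. if $c_{\varphi,\psi}\notin\mathbb{Q}$, then $$h-h(0)=c_1h_\varphi.$$
   Context: $\mathbb{D}=\{z\in\mathbb{C}:|z|<1\}$, and $\rho_{\mathbb{D}}$ denotes the hyperbolic distance in $\mathbb{D}$. The centralizer of $\varphi$ is $\mathcal{Z}_{\forall}(\varphi)=\{\psi:\mathbb{D}\to\mathbb{D}\text{ holomorphic}:\psi\circ\varphi=\varphi\circ\psi\}$. A holomorphic self-map $\varphi$ of $\mathbb{D}$ is parabolic if its iterates converge locally uniformly to a point $\tau\in\partial\mathbb{D}$ (its Denjoy–Wolff point) and the angular derivative satisfies $\varphi'(\tau)=1$. It is of zero hyperbolic step if $\lim_{n\to\infty}\rho_{\mathbb{D}}(\varphi^{\circ n}(z),\varphi^{\circ(n+1)}(z))=0$ for some (equivalently, all) $z\in\mathbb{D}$. Koenigs function (parabolic, zero hyperbolic step): $h_\varphi$ is the unique holomorphic function $g:\mathbb{D}\to\mathbb{C}$ with $g(0)=0$ such that $g\circ\varphi=g+1$, $\mathbb{C}=\bigcup_{n\ge0}(g(\mathbb{D})-n)$,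 and $g$ is injective on some $\varphi$-absorbing domain, i.e. a domain $V\subset\mathbb{D}$ with $\varphi(V)\subset V$ and $\mathbb{D}=\bigcup_{n\in\mathbb{N}}(\varphi^{\circ n})^{-1}(V)$. Simultaneous linearization coefficient: for $\varphi$ parabolic of zero hyperbolic step and $\psi\in\mathcal{Z}_{\forall}(\varphi)$, the function $h_\varphi\circ\psi-h_\varphi$ is constant; $c_{\varphi,\psi}\in\mathbb{C}$ denotes this constant, so $h_\varphi\circ\psi=h_\varphi+c_{\varphi,\psi}$. *)

(* Defs.v *)
(* A function on the unit disc is a total function C -> C of which only the
   values on the disc matter. *)
From Stdlib Require Import Reals QArith Qreals.
From Coquelicot Require Import Coquelicot.
Open Scope R_scope.

Definition unit_disc (z : C) : Prop := Cmod z < 1.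

Definition holomorphic_on (U : C -> Prop) (f : C -> C) : Prop :=
  forall z : C, U z -> @ex_derive C_AbsRing C_NormedModule f z.

Definition holomorphic_self_map (phi : C -> C) : Prop :=
  holomorphic_on unit_disc phi /\ (forall z : C, unit_disc z -> unit_disc (phi z)).

Definition iterate (phi : C -> C) (n : nat) (z : C) : C := Nat.iter n phi z.

(* Normalized to have curvature -4. *)
Definition hyp_dist (z w : C) : R :=
  let t := Cmod (z - w)%C / Cmod (1 - Cconj w * z)%C in
  / 2 * ln ((1 + t) / (1 - t)).

Definition connected_set (V : C -> Prop) : Prop :=
  forall U1 U2 : C -> Prop,
    open U1 -> open U2 ->
    (forall z : C, V z -> U1 z \/ U2 z) ->
    (forall z : C, V z -> U1 z -> U2 z -> False) ->
    (forall z : C, V z -> U1 z) \/ (forall z : C, V z -> U2 z).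

Definition domain (V : C -> Prop) : Prop :=
  open V /\ (exists z : C, V z) /\ connected_set V.

(* Empty for M <= 1, since 1 - |z| <= |tau - z| when |tau| = 1. *)
Definition stolz_region (tau : C) (M : R) (z : C) : Prop :=
  unit_disc z /\ Cmod (tau - z)%C < M * (1 - Cmod z).

Definition angular_limit (f : C -> C) (tau l : C) : Prop :=
  forall M : R, filterlim f (within (stolz_region tau M) (locally tau)) (locally l).

(* The boundary value of f at tau is its angular limit w, not f tau. *)
Definition angular_derivative (f : C -> C) (tau d : C) : Prop :=
  exists w : C,
    angular_limit f tau w /\
    angular_limit (fun z => (f z - w) / (z - tau))%C tau d.

Definition denjoy_wolff_limit (phi : C -> C) (tau : C) : Prop :=
  forall z : C, unit_disc z ->
    exists U : C -> Prop,
      locally z U /\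
      forall eps : posreal,
        eventually (fun n : nat =>
          forall w : C, unit_disc w -> U w -> Cmod (iterate phi n w - tau)%C < eps).

Definition parabolic (phi : C -> C) : Prop :=
  holomorphic_self_map phi /\
  exists tau : C,
    Cmod tau = 1 /\
    denjoy_wolff_limit phi tau /\
    angular_derivative phi tau 1%C.

Definition zero_hyperbolic_step (phi : C -> C) : Prop :=
  exists z : C, unit_disc z /\
    is_lim_seq (fun n : nat => hyp_dist (iterate phi n z) (iterate phi (S n) z)) 0.

Definition absorbing_domain (phi : C -> C) (V : C -> Prop) : Prop :=
  domain V /\
  (forall z : C, V z -> unit_disc z) /\
  (forall z : C, V z -> V (phi z)) /\
  (forall z : C, unit_disc z -> exists n : nat, V (iterate phi n z)).

Definition injective_on (V : C -> Prop) (g : C -> C) : Prop :=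
  forall z w : C, V z -> V w -> g z = g w -> z = w.

(* Characterizes g, on the disc, when phi is parabolic of zero hyperbolic step. *)
Definition koenigs_function (phi g : C -> C) : Prop :=
  holomorphic_on unit_disc g /\
  g 0%C = 0%C /\
  (forall z : C, unit_disc z -> g (phi z) = (g z + 1)%C) /\
  (forall w : C, exists (n : nat) (z : C), unit_disc z /\ w = (g z - INR n)%C) /\
  (exists V : C -> Prop, absorbing_domain phi V /\ injective_on V g).

Definition centralizer (phi psi : C -> C) : Prop :=
  holomorphic_self_map psi /\
  (forall z : C, unit_disc z -> psi (phi z) = phi (psi z)).

(* c is the constant value of hphi o psi - hphi on the disc. *)
Definition linearization_coefficient (hphi psi : C -> C) (c : C) : Prop :=
  forall z : C, unit_disc z -> (hphi (psi z) - hphi z)%C = c.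

Definition rational (c : C) : Prop := exists q : Q, c = RtoC (Q2R q).

(* Main.v *)
Require Import Defs.
From Stdlib Require Import Reals QArith Qreals.
From Coquelicot Require Import Coquelicot.
From Stdlib Require Import ZArith Lra Lia ClassicalEpsilon Classical.
Open Scope R_scope.

(** Put g = h_phi, f = h - c1 g and d = c2 - c1 c, so that f o phi = f and f o psi = f + d.
    Since g is injective on an absorbing domain and its translates cover the plane, f = F o g
    for a function F on the plane with F (w + 1) = F w and F (w + c) = F w + d; the claim is
    that f is constant. F is continuous because g is open, and this suffices; the
    nonvanishing of g' is never needed.

    If c is real, F is bounded on the real line, hence d = 0, and F has arbitrarily small
    real periods because c is irrational; so f takes the value f z at points different
    from z and arbitrarily close to it, and f' = 0.

    If c is not real, some purely imaginary lambda makes Re (F w - lambda w) doubly periodic.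
    It attains a maximum, so by the maximum principle, applied to f and g, it is constant.
    Then f - lambda g is constant, and comparing its values at z and phi z gives lambda = 0.

    The maximum principle comes from Goursat's theorem on squares: Cauchy's formula at the
    centre bounds |f| there by a constant times its maximum on the boundary, and
    the constant disappears on replacing f by its powers. *)

(** * Carathéodory derivatives *)

(** Irrationality is what excludes other solutions: for c = p / q, the function exp (2 pi i q g) is
    invariant under phi and psi, so g + exp (2 pi i q g) satisfies both functional equations. For c
    not real, Re (lambda w) with lambda imaginary depends only on Im w, so the period 1 survives.
    The one real parameter in lambda cancels Re d along c but leaves Im d alone, which is why only a
    real part becomes doubly periodic. Its maximum does not contradict anything yet: comparing a
    centre with the boundary of a square excludes only strict maxima. If the periodic function is
    smaller at some p than its maximum, adding a small multiple of 1 / |w - p|^2 creates a strict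
    maximum, and injectivity of g carries it back to a strict local maximum of the real part of a
    holomorphic function on the disc. Openness of g also comes from injectivity: a value taken only
    once near a point is interior to the image, again by the maximum principle. *)

Definition continuous_at (f : C -> C) (z : C) : Prop :=
  forall eps : R, 0 < eps -> exists del : R, 0 < del /\
    forall w : C, Cmod (w - z)%C < del -> Cmod (f w - f z)%C < eps.

(* Carathéodory's form of differentiability, which turns the product, quotient
   and chain rules into continuity of products, quotients and composites. *)
Definition derivative_at (f : C -> C) (z d : C) : Prop :=
  exists q : C -> C, continuous_at q z /\ q z = d /\
    exists del : R, 0 < del /\
      forall w : C, Cmod (w - z)%C < del -> (f w - f z)%C = (q w * (w - z))%C.

Definition differentiable_at (f : C -> C) (z : C) : Prop :=
  exists d : C, derivative_at f z d.

Lemma Cmod_sub_sym (z w : C) : Cmod (z - w)%C = Cmod (w - z)%C.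
Proof. rewrite <- Cmod_opp; f_equal; ring. Qed.

Lemma Cmod_sub_diag (z : C) : Cmod (z - z)%C = 0.
Proof. replace (z - z)%C with (RtoC 0) by ring. apply Cmod_0. Qed.

Lemma Cmod_le_sub (z w : C) : Cmod z <= Cmod w + Cmod (z - w)%C.
Proof. replace z with (w + (z - w))%C at 1 by ring. apply Cmod_triangle. Qed.

Lemma Cmod_sub_triangle (x y z : C) : Cmod (x - z)%C <= Cmod (x - y)%C + Cmod (y - z)%C.
Proof. replace (x - z)%C with ((x - y) + (y - z))%C by ring. apply Cmod_triangle. Qed.

Lemma Im_le_Cmod (z : C) : Rabs (Im z) <= Cmod z.
Proof. eapply Rle_trans; [apply Rmax_r|apply Rmax_Cmod]. Qed.

Lemma Cmod_le_Re_Im (z : C) : Cmod z <= Rabs (Re z) + Rabs (Im z).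
Proof.
  replace z with (RtoC (Re z) + RtoC (Im z) * Ci)%C at 1.
  - eapply Rle_trans; [apply Cmod_triangle|].
    rewrite Cmod_mult, !Cmod_R, Cmod_Ci. lra.
  - destruct z; unfold Cplus, Cmult, RtoC, Ci, Re, Im; simpl; f_equal; ring.
Qed.

Lemma RtoC_Cmod_minus (a b : R) : Cmod (RtoC a - RtoC b)%C = Rabs (a - b).
Proof. now rewrite <- RtoC_minus, Cmod_R. Qed.

Lemma continuous_at_local (f g : C -> C) (z : C) (r : R) :
  0 < r -> (forall w : C, Cmod (w - z)%C < r -> f w = g w) ->
  continuous_at f z -> continuous_at g z.
Proof.
  intros Hr E Hf eps He. destruct (Hf eps He) as [d [Hd H]].
  exists (Rmin d r). split; [now apply Rmin_pos|]. intros w Hw.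
  rewrite <- !E.
  - apply H. eapply Rlt_le_trans; [apply Hw|apply Rmin_l].
  - now rewrite Cmod_sub_diag.
  - eapply Rlt_le_trans; [apply Hw|apply Rmin_r].
Qed.

Lemma continuous_at_const (a z : C) : continuous_at (fun _ => a) z.
Proof. intros eps He. exists 1. split; [lra|]. intros. now rewrite Cmod_sub_diag. Qed.

Lemma continuous_at_id (z : C) : continuous_at (fun w => w) z.
Proof. intros eps He. exists eps. auto. Qed.

Lemma continuous_at_plus (f g : C -> C) (z : C) :
  continuous_at f z -> continuous_at g z -> continuous_at (fun w => (f w + g w)%C) z.
Proof.
  intros Hf Hg eps He.
  destruct (Hf (eps / 2)) as [d1 [Hd1 H1]]; [lra|].
  destruct (Hg (eps / 2)) as [d2 [Hd2 H2]]; [lra|].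
  exists (Rmin d1 d2). split; [now apply Rmin_pos|]. intros w Hw.
  replace (f w + g w - (f z + g z))%C with ((f w - f z) + (g w - g z))%C by ring.
  eapply Rle_lt_trans; [apply Cmod_triangle|].
  specialize (H1 w (Rlt_le_trans _ _ _ Hw (Rmin_l _ _))).
  specialize (H2 w (Rlt_le_trans _ _ _ Hw (Rmin_r _ _))). lra.
Qed.

Lemma continuous_at_bounded (f : C -> C) (z : C) :
  continuous_at f z -> exists del : R, 0 < del /\
    forall w : C, Cmod (w - z)%C < del -> Cmod (f w) < Cmod (f z) + 1.
Proof.
  intros Hf. destruct (Hf 1) as [d [Hd H]]; [lra|]. exists d. split; [easy|].
  intros w Hw. specialize (H w Hw). pose proof (Cmod_le_sub (f w) (f z)). lra.
Qed.

Lemma continuous_at_mult (f g : C -> C) (z : C) :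
  continuous_at f z -> continuous_at g z -> continuous_at (fun w => (f w * g w)%C) z.
Proof.
  intros Hf Hg eps He.
  destruct (continuous_at_bounded f z Hf) as [d0 [Hd0 H0]].
  pose proof (Cmod_ge_0 (f z)) as Pf. pose proof (Cmod_ge_0 (g z)) as Pg.
  destruct (Hf (eps / (2 * (Cmod (g z) + 1)))) as [d1 [Hd1 H1]].
  { apply Rdiv_lt_0_compat; lra. }
  destruct (Hg (eps / (2 * (Cmod (f z) + 1)))) as [d2 [Hd2 H2]].
  { apply Rdiv_lt_0_compat; lra. }
  exists (Rmin d0 (Rmin d1 d2)). split; [repeat apply Rmin_pos; lra|]. intros w Hw.
  apply Rmin_Rgt_l in Hw as [Hw0 Hw]. apply Rmin_Rgt_l in Hw as [Hw1 Hw2].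
  specialize (H0 w Hw0). specialize (H1 w Hw1). specialize (H2 w Hw2).
  replace (f w * g w - f z * g z)%C with (f w * (g w - g z) + (f w - f z) * g z)%C by ring.
  eapply Rle_lt_trans; [apply Cmod_triangle|]. rewrite !Cmod_mult.
  assert (A1 : Cmod (f w) * Cmod (g w - g z)%C <= eps / 2).
  { replace (eps / 2) with ((Cmod (f z) + 1) * (eps / (2 * (Cmod (f z) + 1)))) by (field; lra).
    apply Rmult_le_compat; try apply Cmod_ge_0; lra. }
  assert (A2 : Cmod (f w - f z)%C * (Cmod (g z) + 1) < eps / 2).
  { replace (eps / 2) with ((eps / (2 * (Cmod (g z) + 1))) * (Cmod (g z) + 1)) by (field; lra).
    apply Rmult_lt_compat_r; lra. }
  pose proof (Cmod_ge_0 (f w - f z)%C). nra.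
Qed.

Lemma continuous_at_inv (f : C -> C) (z : C) :
  continuous_at f z -> f z <> RtoC 0 -> continuous_at (fun w => (/ f w)%C) z.
Proof.
  intros Hf Hz eps He. apply Cmod_gt_0 in Hz as Pz.
  destruct (Hf (Cmod (f z) / 2)) as [d0 [Hd0 H0]]; [lra|].
  destruct (Hf (eps * (Cmod (f z) * Cmod (f z) / 2))) as [d1 [Hd1 H1]].
  { apply Rmult_lt_0_compat; [easy|]. nra. }
  exists (Rmin d0 d1). split; [now apply Rmin_pos|]. intros w Hw.
  apply Rmin_Rgt_l in Hw as [Hw0 Hw1]. specialize (H0 w Hw0). specialize (H1 w Hw1).
  assert (Pw : Cmod (f z) / 2 < Cmod (f w)).
  { pose proof (Cmod_le_sub (f z) (f w)). rewrite Cmod_sub_sym in H. lra. }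
  assert (Nw : f w <> RtoC 0) by (apply Cmod_gt_0; lra).
  replace (/ f w - / f z)%C with (- (f w - f z) * / (f w * f z))%C by (field; easy).
  rewrite Cmod_mult, Cmod_opp, Cmod_inv by now apply Cmult_neq_0.
  rewrite Cmod_mult.
  apply Rmult_lt_reg_r with (Cmod (f w) * Cmod (f z)); [nra|].
  rewrite Rmult_assoc, Rinv_l by nra. rewrite Rmult_1_r.
  eapply Rlt_le_trans; [apply H1|]. apply Rmult_le_compat_l; nra.
Qed.

Lemma continuous_at_comp (f g : C -> C) (z : C) :
  continuous_at f z -> continuous_at g (f z) -> continuous_at (fun w => g (f w)) z.
Proof.
  intros Hf Hg eps He. destruct (Hg eps He) as [d [Hd H]].
  destruct (Hf d Hd) as [d' [Hd' H']]. exists d'. split; auto.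
Qed.

Lemma continuous_at_Re (z : C) : continuous_at (fun w => RtoC (Re w)) z.
Proof.
  intros eps He. exists eps. split; [easy|]. intros w Hw. rewrite RtoC_Cmod_minus.
  eapply Rle_lt_trans; [|apply Hw]. eapply Rle_trans; [|apply re_le_Cmod].
  right; f_equal.
Qed.

Lemma continuous_at_Im (z : C) : continuous_at (fun w => RtoC (Im w)) z.
Proof.
  intros eps He. exists eps. split; [easy|]. intros w Hw. rewrite RtoC_Cmod_minus.
  eapply Rle_lt_trans; [|apply Hw]. eapply Rle_trans; [|apply Im_le_Cmod].
  right; f_equal.
Qed.

Lemma continuous_at_Cmod (z : C) : continuous_at (fun w => RtoC (Cmod w)) z.
Proof.
  intros eps He. exists eps. split; [easy|]. intros w Hw. rewrite RtoC_Cmod_minus.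
  eapply Rle_lt_trans; [|apply Hw]. pose proof (Cmod_le_sub w z).
  pose proof (Cmod_le_sub z w). rewrite (Cmod_sub_sym z w) in H0.
  apply Rabs_le; lra.
Qed.

(** The slope function is the difference quotient, completed at z by the derivative. *)
Lemma differentiable_at_of_ex_derive (f : C -> C) (z : C) :
  @ex_derive C_AbsRing C_NormedModule f z -> differentiable_at f z.
Proof.
  intros [d [_ H]].
  exists d, (fun w => if Ceq_dec w z then d else ((f w - f z) / (w - z))%C).
  split; [|split].
  - intros eps He.
    assert (Q : is_filter_lim (locally (z : AbsRing_UniformSpace C_AbsRing)) z) by (intros P HP; exact HP).
    assert (He2 : 0 < eps / 2) by lra.
    specialize (H z Q (mkposreal _ He2)).
    destruct H as [del H]. exists del. split; [apply cond_pos|]. intros w Hw.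
    destruct (Ceq_dec z z) as [_|]; [|easy].
    destruct (Ceq_dec w z) as [E|E].
    + now rewrite Cmod_sub_diag.
    + assert (N : (w - z)%C <> RtoC 0) by now apply Cminus_eq_contra.
      specialize (H w Hw).
      change (Cmod (f w - f z - (w - z) * d)%C <= eps / 2 * Cmod (w - z)%C) in H.
      replace ((f w - f z) / (w - z) - d)%C with ((f w - f z - (w - z) * d) / (w - z))%C
        by (field; easy).
      apply Cmod_gt_0 in N as P. rewrite Cmod_div by easy.
      apply Rle_lt_trans with (eps / 2); [|lra].
      apply Rmult_le_reg_r with (Cmod (w - z)%C); [easy|].
      unfold Rdiv at 1. rewrite Rmult_assoc, Rinv_l by lra. lra.
  - destruct (Ceq_dec z z); easy.
  - exists 1. split; [lra|]. intros w _. destruct (Ceq_dec w z) as [->|E].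
    + ring.
    + field. now apply Cminus_eq_contra.
Qed.

Lemma derivative_at_continuous (f : C -> C) (z d : C) :
  derivative_at f z d -> continuous_at f z.
Proof.
  intros [q [Hq [_ [r [Hr E]]]]].
  apply (continuous_at_local (fun w => (f z + q w * (w - z))%C) f z r Hr).
  - intros w Hw. rewrite <- E by easy. ring.
  - apply continuous_at_plus; [apply continuous_at_const|].
    apply continuous_at_mult; [easy|].
    apply (continuous_at_plus (fun w => w) (fun _ => (- z)%C));
      [apply continuous_at_id|apply continuous_at_const].
Qed.

Lemma differentiable_at_continuous (f : C -> C) (z : C) :
  differentiable_at f z -> continuous_at f z.
Proof. intros [d H]. now apply derivative_at_continuous in H. Qed.

Lemma derivative_at_local (f g : C -> C) (z d : C) (r : R) :
  0 < r -> (forall w : C, Cmod (w - z)%C < r -> f w = g w) ->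
  derivative_at f z d -> derivative_at g z d.
Proof.
  intros Hr E [q [Hq [Hd [s [Hs Hf]]]]]. exists q. split; [easy|]. split; [easy|].
  exists (Rmin r s). split; [now apply Rmin_pos|]. intros w Hw.
  apply Rmin_Rgt_l in Hw as [Hw0 Hw1]. rewrite <- !E; auto.
  now rewrite Cmod_sub_diag.
Qed.

Lemma derivative_at_const (a z : C) : derivative_at (fun _ => a) z 0.
Proof.
  exists (fun _ => RtoC 0). split; [apply continuous_at_const|]. split; [easy|].
  exists 1. split; [lra|]. intros; ring.
Qed.

Lemma derivative_at_id (z : C) : derivative_at (fun w => w) z 1.
Proof.
  exists (fun _ => RtoC 1). split; [apply continuous_at_const|]. split; [easy|].
  exists 1. split; [lra|]. intros; ring.
Qed.

Lemma derivative_at_plus (f g : C -> C) (z a b : C) :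
  derivative_at f z a -> derivative_at g z b ->
  derivative_at (fun w => (f w + g w)%C) z (a + b)%C.
Proof.
  intros [q [Hq [<- [r [Hr Hf]]]]] [p [Hp [<- [s [Hs Hg]]]]].
  exists (fun w => (q w + p w)%C). split; [now apply continuous_at_plus|].
  split; [easy|]. exists (Rmin r s). split; [now apply Rmin_pos|]. intros w Hw.
  apply Rmin_Rgt_l in Hw as [Hw0 Hw1].
  rewrite Cmult_plus_distr_r, <- Hf, <- Hg by easy. ring.
Qed.

Lemma derivative_at_mult (f g : C -> C) (z a b : C) :
  derivative_at f z a -> derivative_at g z b ->
  derivative_at (fun w => (f w * g w)%C) z (a * g z + f z * b)%C.
Proof.
  intros Df Dg. pose proof (derivative_at_continuous _ _ _ Df) as Cf.
  destruct Df as [q [Hq [<- [r [Hr Hf]]]]]. destruct Dg as [p [Hp [<- [s [Hs Hg]]]]].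
  exists (fun w => (q w * g z + f w * p w)%C). split.
  - apply continuous_at_plus; apply continuous_at_mult; auto using continuous_at_const.
  - split; [easy|]. exists (Rmin r s). split; [now apply Rmin_pos|]. intros w Hw.
    apply Rmin_Rgt_l in Hw as [Hw0 Hw1].
    replace ((q w * g z + f w * p w) * (w - z))%C
      with (q w * (w - z) * g z + f w * (p w * (w - z)))%C by ring.
    rewrite <- Hf, <- Hg by easy. ring.
Qed.

Lemma continuous_at_neq0 (f : C -> C) (z : C) :
  continuous_at f z -> f z <> RtoC 0 ->
  exists r : R, 0 < r /\ forall w : C, Cmod (w - z)%C < r -> f w <> RtoC 0.
Proof.
  intros Hf Hz. apply Cmod_gt_0 in Hz. destruct (Hf _ Hz) as [r [Hr H]].
  exists r. split; [easy|]. intros w Hw E. specialize (H w Hw). rewrite E in H.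
  replace (0 - f z)%C with (- f z)%C in H by ring. rewrite Cmod_opp in H. lra.
Qed.

Lemma differentiable_at_inv (f : C -> C) (z : C) :
  differentiable_at f z -> f z <> RtoC 0 -> differentiable_at (fun w => (/ f w)%C) z.
Proof.
  intros Df Hz. pose proof (differentiable_at_continuous _ _ Df) as Cf.
  destruct Df as [d [q [Hq [<- [r [Hr Hf]]]]]].
  destruct (continuous_at_neq0 f z Cf Hz) as [s [Hs Nf]].
  exists (- q z * / (f z * f z))%C, (fun w => (- q w * / (f w * f z))%C). split.
  - apply continuous_at_mult.
    + apply (continuous_at_comp q (fun w => (- w)%C)); [easy|].
      intros eps He. exists eps. split; [easy|]. intros w Hw.
      replace (- w - - q z)%C with (- (w - q z))%C by ring. now rewrite Cmod_opp.
    + apply continuous_at_inv; [|now apply Cmult_neq_0].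
      apply continuous_at_mult; auto using continuous_at_const.
  - split; [easy|]. exists (Rmin r s). split; [now apply Rmin_pos|]. intros w Hw.
    apply Rmin_Rgt_l in Hw as [Hw0 Hw1].
    replace (- q w * / (f w * f z) * (w - z))%C
      with (- (q w * (w - z)) * / (f w * f z))%C by ring.
    rewrite <- Hf by easy. field. split; auto.
Qed.

(** The slopes multiply, so the points w with f w = f z need no separate treatment. *)
Lemma derivative_at_comp (f g : C -> C) (z a b : C) :
  derivative_at f z a -> derivative_at g (f z) b ->
  derivative_at (fun w => g (f w)) z (b * a)%C.
Proof.
  intros Df Dg. pose proof (derivative_at_continuous _ _ _ Df) as Cf.
  destruct Df as [q [Hq [<- [r [Hr Hf]]]]]. destruct Dg as [p [Hp [<- [s [Hs Hg]]]]].
  destruct (Cf s Hs) as [t [Ht Hft]].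
  exists (fun w => (p (f w) * q w)%C). split.
  - apply continuous_at_mult; [|easy]. now apply (continuous_at_comp f p).
  - split; [easy|]. exists (Rmin r t). split; [now apply Rmin_pos|]. intros w Hw.
    apply Rmin_Rgt_l in Hw as [Hw0 Hw1].
    rewrite Hg by auto. rewrite Hf by auto. ring.
Qed.

Lemma differentiable_at_local (f g : C -> C) (z : C) (r : R) :
  0 < r -> (forall w : C, Cmod (w - z)%C < r -> f w = g w) ->
  differentiable_at f z -> differentiable_at g z.
Proof. intros Hr E [d H]. exists d. now apply (derivative_at_local f g z d r). Qed.

Lemma differentiable_at_const (a z : C) : differentiable_at (fun _ => a) z.
Proof. eexists; apply derivative_at_const. Qed.

Lemma differentiable_at_id (z : C) : differentiable_at (fun w => w) z.
Proof. eexists; apply derivative_at_id. Qed.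

Lemma differentiable_at_plus (f g : C -> C) (z : C) :
  differentiable_at f z -> differentiable_at g z ->
  differentiable_at (fun w => (f w + g w)%C) z.
Proof. intros [a Ha] [b Hb]. eexists; apply derivative_at_plus; eauto. Qed.

Lemma differentiable_at_mult (f g : C -> C) (z : C) :
  differentiable_at f z -> differentiable_at g z ->
  differentiable_at (fun w => (f w * g w)%C) z.
Proof. intros [a Ha] [b Hb]. eexists; apply derivative_at_mult; eauto. Qed.

Lemma differentiable_at_minus (f g : C -> C) (z : C) :
  differentiable_at f z -> differentiable_at g z ->
  differentiable_at (fun w => (f w - g w)%C) z.
Proof.
  intros Hf Hg.
  apply (differentiable_at_local (fun w => (f w + (- (1)) * g w)%C) _ z 1); [lra| |].
  - intros; ring.
  - apply differentiable_at_plus; [easy|].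
    apply differentiable_at_mult; [apply differentiable_at_const|easy].
Qed.

Lemma continuous_at_minus (f g : C -> C) (z : C) :
  continuous_at f z -> continuous_at g z -> continuous_at (fun w => (f w - g w)%C) z.
Proof.
  intros Hf Hg.
  apply (continuous_at_local (fun w => (f w + (- (1)) * g w)%C) _ z 1); [lra| |].
  - intros; ring.
  - apply continuous_at_plus; [easy|].
    apply continuous_at_mult; [apply continuous_at_const|easy].
Qed.

Lemma differentiable_at_pow (f : C -> C) (z : C) (n : nat) :
  differentiable_at f z -> differentiable_at (fun w => (f w ^ n)%C) z.
Proof.
  intros Hf. induction n as [|n IH].
  - apply (differentiable_at_const 1).
  - now apply (differentiable_at_mult f (fun w => (f w ^ n)%C)).
Qed.

Lemma derivative_at_approx (f : C -> C) (z d : C) (eps : R) :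
  derivative_at f z d -> 0 < eps ->
  exists del : R, 0 < del /\ forall w : C, Cmod (w - z)%C < del ->
    Cmod (f w - f z - d * (w - z))%C <= eps * Cmod (w - z)%C.
Proof.
  intros [q [Hq [<- [r [Hr Hf]]]]] He. destruct (Hq eps He) as [s [Hs H]].
  exists (Rmin r s). split; [now apply Rmin_pos|]. intros w Hw.
  apply Rmin_Rgt_l in Hw as [Hw0 Hw1]. rewrite Hf by easy.
  replace (q w * (w - z) - q z * (w - z))%C with ((q w - q z) * (w - z))%C by ring.
  rewrite Cmod_mult. apply Rmult_le_compat_r; [apply Cmod_ge_0|]. left; auto.
Qed.

(** * Bisection and compactness of squares *)

Definition in_square (x y l : R) (p : C) : Prop :=
  x <= Re p <= x + l /\ y <= Im p <= y + l.

Lemma nested_intervals (a b : nat -> R) :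
  (forall n, a n <= a (S n)) -> (forall n, b (S n) <= b n) -> (forall n, a n <= b n) ->
  exists p : R, forall n, a n <= p <= b n.
Proof.
  intros Ha Hb Hab.
  assert (Ma : forall n k, a n <= a (n + k)%nat).
  { intros n k. induction k. - rewrite Nat.add_0_r; lra.
    - rewrite Nat.add_succ_r. specialize (Ha (n + k)%nat); lra. }
  assert (Mb : forall n k, b (n + k)%nat <= b n).
  { intros n k. induction k. - rewrite Nat.add_0_r; lra.
    - rewrite Nat.add_succ_r. specialize (Hb (n + k)%nat); lra. }
  assert (Mab : forall m n, a m <= b n).
  { intros m n. apply Rle_trans with (a (m + n)%nat); [apply Ma|].
    apply Rle_trans with (b (m + n)%nat); [apply Hab|]. rewrite Nat.add_comm. apply Mb. }
  destruct (completeness (fun x => exists n, x = a n)) as [p [Hp1 Hp2]].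
  - exists (b 0%nat). intros x [n ->]. apply Mab.
  - exists (a 0%nat), 0%nat. easy.
  - exists p. intros n. split.
    + apply Hp1. now exists n.
    + apply Hp2. intros x [m ->]. apply Mab.
Qed.

(* Bisection: a failure on a square propagates to nested squares of side l / 2^n,
   which shrink to a point. *)
Lemma square_induction (P : R -> R -> R -> Prop) (x y l : R) :
  0 < l ->
  (forall x y l, 0 < l -> P x y l -> P (x + l) y l -> P x (y + l) l -> P (x + l) (y + l) l ->
     P x y (2 * l)) ->
  (forall p : C, exists del : R, 0 < del /\
     forall x y l, 0 < l < del -> in_square x y l p -> P x y l) ->
  P x y l.
Proof.
  intros Hl Hsub Hloc. apply NNPP. intros HP.
  assert (step : forall s : R * R * R, exists s' : R * R * R,
    let '(x, y, l) := s in let '(x', y', l') := s' in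
    0 < l -> ~ P x y l ->
    l' = l / 2 /\ x <= x' /\ x' + l' <= x + l /\ y <= y' /\ y' + l' <= y + l /\ ~ P x' y' l').
  { clear - Hsub. intros [[x y] l].
    (* The triple (0, 0, 0) is a dummy for squares that are degenerate or do not fail; it makes the
       choice of the next square total. *)
    destruct (Rlt_dec 0 l) as [Hl|Hl]; [|now exists (0, 0, 0)].
    destruct (classic (P x y l)) as [H|H]; [now exists (0, 0, 0)|].
    assert (Hh : 0 < l / 2) by lra. specialize (Hsub x y (l / 2) Hh).
    replace (2 * (l / 2)) with l in Hsub by field.
    destruct (classic (P x y (l / 2))) as [H1|H1]; [|exists (x, y, l / 2); repeat split; auto; lra].
    destruct (classic (P (x + l / 2) y (l / 2))) as [H2|H2];
      [|exists (x + l / 2, y, l / 2); repeat split; auto; lra].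
    destruct (classic (P x (y + l / 2) (l / 2))) as [H3|H3];
      [|exists (x, y + l / 2, l / 2); repeat split; auto; lra].
    exists (x + l / 2, y + l / 2, l / 2); repeat split; auto; lra. }
  set (next := fun s => proj1_sig (constructive_indefinite_description _ (step s))).
  assert (Hnext : forall s, let '(x, y, l) := s in let '(x', y', l') := next s in
    0 < l -> ~ P x y l ->
    l' = l / 2 /\ x <= x' /\ x' + l' <= x + l /\ y <= y' /\ y' + l' <= y + l /\ ~ P x' y' l').
  { intros s. unfold next. destruct (constructive_indefinite_description _ (step s)) as [s' H].
    exact H. }
  set (sq := fun n => Nat.iter n next (x, y, l)).
  assert (Hsq : forall n, let '(a, b, m) := sq n in let '(a', b', m') := sq (S n) in
    (0 < m /\ m = l * / 2 ^ n /\ ~ P a b m) /\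
     a <= a' /\ a' + m' <= a + m /\ b <= b' /\ b' + m' <= b + m).
  { assert (I : forall n, let '(a, b, m) := sq n in 0 < m /\ m = l * / 2 ^ n /\ ~ P a b m).
    { induction n as [|n IH].
      - simpl. repeat split; auto; field.
      - change (sq (S n)) with (next (sq n)). specialize (Hnext (sq n)).
        destruct (sq n) as [[a b] m]. destruct (next (a, b, m)) as [[a' b'] m'].
        destruct IH as [I1 [I2 I3]].
        destruct (Hnext I1 I3) as [E [_ [_ [_ [_ N]]]]]. subst m'. repeat split; auto; [lra|].
        rewrite I2. simpl. field. apply pow_nonzero; lra. }
    intros n. specialize (I n). change (sq (S n)) with (next (sq n)). specialize (Hnext (sq n)).
    destruct (sq n) as [[a b] m]. destruct (next (a, b, m)) as [[a' b'] m'].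
    destruct I as [I1 [I2 I3]]. specialize (Hnext I1 I3). intuition. }
  destruct (nested_intervals (fun n => fst (fst (sq n))) (fun n => fst (fst (sq n)) + snd (sq n)))
    as [p1 H1].
  1-3: intros n; specialize (Hsq n); destruct (sq n) as [[a b] m];
    destruct (sq (S n)) as [[a' b'] m']; simpl; lra.
  destruct (nested_intervals (fun n => snd (fst (sq n))) (fun n => snd (fst (sq n)) + snd (sq n)))
    as [p2 H2].
  1-3: intros n; specialize (Hsq n); destruct (sq n) as [[a b] m];
    destruct (sq (S n)) as [[a' b'] m']; simpl; lra.
  destruct (Hloc (p1, p2)) as [del [Hdel H]].
  destruct (pow_lt_1_zero (/ 2)) with (y := del / l) as [N HN].
  { rewrite Rabs_pos_eq; lra. }
  { now apply Rdiv_lt_0_compat. }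
  specialize (HN N (le_n _)). specialize (Hsq N). specialize (H1 N). specialize (H2 N).
  destruct (sq N) as [[a b] m]. destruct (sq (S N)) as [[a' b'] m']. simpl in *.
  destruct Hsq as [[M1 [M2 M3]] _]. apply M3, H.
  - split; [easy|]. rewrite M2. rewrite pow_inv, Rabs_pos_eq in HN.
    + apply (Rmult_lt_compat_l l) in HN; [|easy].
      replace (l * (del / l)) with del in HN by (field; lra). lra.
    + left. apply Rinv_0_lt_compat, pow_lt; lra.
  - split; simpl; lra.
Qed.

Lemma in_square_dist (x y l : R) (p w : C) :
  in_square x y l p -> in_square x y l w -> Cmod (w - p)%C <= 2 * l.
Proof.
  intros [H1 H2] [H3 H4]. eapply Rle_trans; [apply Cmod_le_Re_Im|].
  destruct p as [p1 p2], w as [w1 w2]; simpl in *.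
  assert (Rabs (w1 + - p1) <= l) by (apply Rabs_le; lra).
  assert (Rabs (w2 + - p2) <= l) by (apply Rabs_le; lra). lra.
Qed.

(** Bisection in place of a finite subcover: bounds on the four quarters combine, and a small square
    around p inherits the local bound. Since the induction ranges over all squares, containment in
    the original one is carried as a premise. *)
Lemma locally_bounded_above_square (u : C -> R) (x y l : R) :
  0 < l ->
  (forall p, in_square x y l p -> exists B del, 0 < del /\
     forall w, Cmod (w - p)%C < del -> u w <= B) ->
  exists B, forall p, in_square x y l p -> u p <= B.
Proof.
  intros Hl H.
  apply (square_induction (fun x' y' l' =>
    x <= x' /\ x' + l' <= x + l /\ y <= y' /\ y' + l' <= y + l ->
    exists B, forall p, in_square x' y' l' p -> u p <= B) x y l Hl); [| |lra].
  - clear - Hl. intros a b m Hm H1 H2 H3 H4 Hin.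
    destruct H1 as [B1 H1]; [lra|]. destruct H2 as [B2 H2]; [lra|].
    destruct H3 as [B3 H3]; [lra|]. destruct H4 as [B4 H4]; [lra|].
    exists (Rmax (Rmax B1 B2) (Rmax B3 B4)). intros p [P1 P2].
    destruct (Rle_dec (Re p) (a + m)) as [L1|L1]; destruct (Rle_dec (Im p) (b + m)) as [L2|L2].
    + eapply Rle_trans; [|apply Rmax_l]. eapply Rle_trans; [|apply Rmax_l]. apply H1. split; lra.
    + eapply Rle_trans; [|apply Rmax_r]. eapply Rle_trans; [|apply Rmax_l]. apply H3. split; lra.
    + eapply Rle_trans; [|apply Rmax_l]. eapply Rle_trans; [|apply Rmax_r]. apply H2. split; lra.
    + eapply Rle_trans; [|apply Rmax_r]. eapply Rle_trans; [|apply Rmax_r]. apply H4. split; lra.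
  - intros p. destruct (classic (in_square x y l p)) as [Hp|Hp].
    + destruct (H p Hp) as [B [del [Hd HB]]]. exists (del / 2). split; [lra|].
      intros a b m Hm Hin _. exists B. intros w Hw. apply HB.
      pose proof (in_square_dist _ _ _ _ _ Hin Hw). lra.
    + exists 1. split; [lra|]. intros a b m Hm [Q1 Q2] Hs. destruct Hp. split; lra.
Qed.

(** If the supremum S were not attained, 1 / (S - u) would be locally bounded, hence bounded by some
    K, and S - 1 / K would be a smaller upper bound. *)
Lemma max_on_square (u : C -> R) (x y l : R) :
  0 < l ->
  (forall p, in_square x y l p -> continuous_at (fun w => RtoC (u w)) p) ->
  exists p, in_square x y l p /\ forall w, in_square x y l w -> u w <= u p.
Proof.
  intros Hl Hc.
  assert (Hc' : forall p eps, in_square x y l p -> 0 < eps -> exists del, 0 < del /\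
    forall w, Cmod (w - p)%C < del -> u w < u p + eps).
  { intros p eps Hp He. destruct (Hc p Hp eps He) as [d [Hd H]]. exists d. split; [easy|].
    intros w Hw. specialize (H w Hw). rewrite RtoC_Cmod_minus in H.
    apply Rabs_def2 in H. lra. }
  destruct (locally_bounded_above_square u x y l Hl) as [B HB].
  { intros p Hp. destruct (Hc' p 1 Hp) as [d [Hd H]]; [lra|].
    exists (u p + 1), d. split; [easy|]. intros w Hw. left; auto. }
  destruct (completeness (fun v => exists p, in_square x y l p /\ v = u p)) as [S [HS1 HS2]].
  { exists B. intros v [p [Hp ->]]. auto. }
  { exists (u (x, y)), (x, y). split; [|easy]. split; simpl; lra. }
  apply NNPP. intros Hno.
  assert (Hlt : forall p, in_square x y l p -> u p < S).
  { intros p Hp. assert (u p <= S) by (apply HS1; eauto).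
    destruct (Req_dec (u p) S) as [E|E]; [|lra]. destruct Hno. exists p. split; [easy|].
    intros w Hw. rewrite E. apply HS1; eauto. }
  destruct (locally_bounded_above_square (fun w => / (S - u w)) x y l Hl) as [K HK].
  { intros p Hp. specialize (Hlt p Hp).
    destruct (Hc' p ((S - u p) / 2) Hp) as [d [Hd H]]; [lra|].
    exists (/ ((S - u p) / 2)), d. split; [easy|]. intros w Hw. specialize (H w Hw).
    apply Rinv_le_contravar; lra. }
  assert (K0 : 0 < K).
  { assert (Hxy : in_square x y l (x, y)) by (split; simpl; lra).
    eapply Rlt_le_trans; [|apply (HK _ Hxy)]. apply Rinv_0_lt_compat.
    specialize (Hlt _ Hxy). lra. }
  assert (S <= S - / K); [|pose proof (Rinv_0_lt_compat K K0); lra].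
  apply HS2. intros v [p [Hp ->]]. specialize (HK p Hp). specialize (Hlt p Hp).
  apply Rinv_le_contravar in HK; [|apply Rinv_0_lt_compat; lra].
  rewrite Rinv_inv in HK. lra.
Qed.

Definition square_boundary (x y l : R) (z : C) : Prop :=
  exists t, 0 <= t <= l /\
    (z = (x + t, y) \/ z = (x + t, y + l) \/ z = (x + l, y + t) \/ z = (x, y + t)).

Lemma square_boundary_in (x y l : R) (z : C) :
  square_boundary x y l z -> in_square x y l z.
Proof. intros [t [Ht [-> | [-> | [-> | ->]]]]]; split; simpl; lra. Qed.

(** The minimum over each side is attained. Sides are parametrized by Re w, so that the maximum
    theorem for squares applies to segments as well. *)
Lemma square_boundary_lower_bound (u : C -> R) (x y l : R) :
  0 < l ->
  (forall z, square_boundary x y l z -> continuous_at (fun w => RtoC (u w)) z /\ 0 < u z) ->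
  exists eta, 0 < eta /\ forall z, square_boundary x y l z -> eta <= u z.
Proof.
  intros Hl H.
  assert (side : forall s : C -> C,
    (forall w, continuous_at s w) ->
    (forall w, 0 <= Re w <= l -> square_boundary x y l (s w)) ->
    exists eta, 0 < eta /\ forall t, 0 <= t <= l -> eta <= u (s (RtoC t))).
  { intros s Hs Hb.
    destruct (max_on_square (fun w => - u (s w)) 0 0 l Hl) as [p [[Hp1 Hp2] Hp]].
    { intros p [[P1 P2] _]. destruct (H (s p)) as [Hc _]; [apply Hb; lra|].
      pose proof (continuous_at_comp s (fun w => RtoC (u w)) p (Hs p) Hc) as Hk.
      intros eps He. destruct (Hk eps He) as [d [Hd Hw]]. exists d. split; [easy|].
      intros w Hwd. specialize (Hw w Hwd). rewrite RtoC_Cmod_minus in *.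
      replace (- u (s w) - - u (s p)) with (- (u (s w) - u (s p))) by ring.
      now rewrite Rabs_Ropp. }
    exists (u (s p)). split; [apply H, Hb; lra|].
    intros t Ht. specialize (Hp (RtoC t)). simpl in Hp.
    assert (- u (s (RtoC t)) <= - u (s p)); [|lra]. apply Hp. split; simpl; lra. }
  assert (cs : forall a b w, continuous_at (fun w => (a + RtoC (Re w) * b)%C) w).
  { intros a b w. apply continuous_at_plus; [apply continuous_at_const|].
    apply continuous_at_mult; [apply continuous_at_Re|apply continuous_at_const]. }
  destruct (side (fun w => ((x, y) + RtoC (Re w) * 1)%C)) as [e1 [E1 H1]]; [apply cs| |].
  { intros w Hw. exists (Re w). split; [easy|]. left.
    unfold Cplus, Cmult, RtoC; simpl; f_equal; ring. }
  destruct (side (fun w => ((x, (y + l)%R) + RtoC (Re w) * 1)%C)) as [e2 [E2 H2]]; [apply cs| |].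
  { intros w Hw. exists (Re w). split; [easy|]. right; left.
    unfold Cplus, Cmult, RtoC; simpl; f_equal; ring. }
  destruct (side (fun w => (((x + l)%R, y) + RtoC (Re w) * Ci)%C)) as [e3 [E3 H3]]; [apply cs| |].
  { intros w Hw. exists (Re w). split; [easy|]. right; right; left.
    unfold Cplus, Cmult, RtoC; simpl; f_equal; ring. }
  destruct (side (fun w => ((x, y) + RtoC (Re w) * Ci)%C)) as [e4 [E4 H4]]; [apply cs| |].
  { intros w Hw. exists (Re w). split; [easy|]. right; right; right.
    unfold Cplus, Cmult, RtoC; simpl; f_equal; ring. }
  exists (Rmin (Rmin e1 e2) (Rmin e3 e4)). split; [repeat apply Rmin_pos; easy|].
  intros z [t [Ht Hz]]. specialize (H1 t Ht). specialize (H2 t Ht). specialize (H3 t Ht).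
  specialize (H4 t Ht).
  pose proof (Rmin_l (Rmin e1 e2) (Rmin e3 e4)). pose proof (Rmin_r (Rmin e1 e2) (Rmin e3 e4)).
  pose proof (Rmin_l e1 e2). pose proof (Rmin_r e1 e2).
  pose proof (Rmin_l e3 e4). pose proof (Rmin_r e3 e4).
  assert (G : forall e s, e <= u s -> z = s -> e <= u z) by (intros; now subst).
  destruct Hz as [Hz|[Hz|[Hz|Hz]]].
  - enough (e1 <= u z) by lra. apply (G _ _ H1). rewrite Hz.
    unfold Cplus, Cmult, RtoC; simpl; f_equal; ring.
  - enough (e2 <= u z) by lra. apply (G _ _ H2). rewrite Hz.
    unfold Cplus, Cmult, RtoC; simpl; f_equal; ring.
  - enough (e3 <= u z) by lra. apply (G _ _ H3). rewrite Hz.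
    unfold Cplus, Cmult, RtoC; simpl; f_equal; ring.
  - enough (e4 <= u z) by lra. apply (G _ _ H4). rewrite Hz.
    unfold Cplus, Cmult, RtoC; simpl; f_equal; ring.
Qed.

(** * Goursat's theorem on squares *)

(* The integrand of the imaginary part of the contour integral of f along a square:
   all four sides are folded onto [0, l], so that the integrand of an affine f
   vanishes pointwise. *)
Definition contour_integrand (f : C -> C) (x y l t : R) : R :=
  Im (f (x + t, y)) - Im (f (x + t, y + l)) + Re (f (x + l, y + t)) - Re (f (x, y + t)).

Definition contour_integral (f : C -> C) (x y l : R) : R :=
  RInt (contour_integrand f x y l) 0 l.

Lemma continuous_along_path (f : C -> C) (s : R -> C) (t : R) :
  (forall a b, Cmod (s a - s b)%C = Rabs (a - b)) -> continuous_at f (s t) ->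
  continuous (fun t => Re (f (s t))) t /\ continuous (fun t => Im (f (s t))) t.
Proof.
  intros Hs Hf.
  split; apply filterlim_locally; intros eps;
    (destruct (Hf eps (cond_pos eps)) as [d [Hd H]]; exists (mkposreal d Hd); intros t' Ht';
     assert (K : Cmod (f (s t') - f (s t))%C < eps) by (apply H; rewrite Hs; exact Ht'));
    (eapply Rle_lt_trans; [|exact K]).
  - eapply Rle_trans; [|apply re_le_Cmod]. right. reflexivity.
  - eapply Rle_trans; [|apply Im_le_Cmod]. right. reflexivity.
Qed.

Lemma continuous_contour_integrand (f : C -> C) (x y l t : R) :
  0 <= t <= l -> (forall p, in_square x y l p -> continuous_at f p) ->
  continuous (contour_integrand f x y l) t.
Proof.
  intros Ht Hf.
  assert (Hh : forall y' a b, Cmod ((x + a, y')%R - (x + b, y')%R)%C = Rabs (a - b)).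
  { intros y' a b. rewrite <- Cmod_R. f_equal. unfold Cminus, Cplus, Copp, RtoC; simpl.
    f_equal; ring. }
  assert (Hv : forall x' a b, Cmod ((x', y + a)%R - (x', y + b)%R)%C = Rabs (a - b)).
  { intros x' a b. replace ((x', y + a)%R - (x', y + b)%R)%C with (Ci * RtoC (a - b))%C.
    - now rewrite Cmod_mult, Cmod_Ci, Cmod_R, Rmult_1_l.
    - unfold Ci, Cminus, Cplus, Copp, Cmult, RtoC; simpl. f_equal; ring. }
  unfold contour_integrand.
  apply (continuous_minus (V := R_NormedModule)); [apply (continuous_plus (V := R_NormedModule));
    [apply (continuous_minus (V := R_NormedModule))|]|].
  - refine (proj2 (continuous_along_path f (fun t => (x + t, y)) t _ _)); [intros; apply Hh|].
    apply Hf; split; simpl; lra.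
  - refine (proj2 (continuous_along_path f (fun t => (x + t, y + l)) t _ _)); [intros; apply Hh|].
    apply Hf; split; simpl; lra.
  - refine (proj1 (continuous_along_path f (fun t => (x + l, y + t)) t _ _)); [intros; apply Hv|].
    apply Hf; split; simpl; lra.
  - refine (proj1 (continuous_along_path f (fun t => (x, y + t)) t _ _)); [intros; apply Hv|].
    apply Hf; split; simpl; lra.
Qed.

Lemma ex_RInt_contour_integrand (f : C -> C) (x y l : R) :
  0 <= l -> (forall p, in_square x y l p -> continuous_at f p) ->
  ex_RInt (contour_integrand f x y l) 0 l.
Proof.
  intros Hl Hf. apply (ex_RInt_continuous (V := R_CompleteNormedModule)). intros t Ht.
  rewrite Rmin_left, Rmax_right in Ht by easy. now apply continuous_contour_integrand.
Qed.

(** After the half over [l, 2 l] is shifted to [0, l], the sides shared by neighbouring quarters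
    cancel in the sum of the integrands, pointwise in t. *)
Lemma contour_integral_subdivide (f : C -> C) (x y l : R) :
  0 < l -> (forall p, in_square x y (2 * l) p -> continuous_at f p) ->
  contour_integral f x y (2 * l) =
    contour_integral f x y l + contour_integral f (x + l) y l
    + contour_integral f x (y + l) l + contour_integral f (x + l) (y + l) l.
Proof.
  intros Hl Hf.
  assert (E1 : ex_RInt (contour_integrand f x y l) 0 l).
  { apply ex_RInt_contour_integrand; [lra|]. intros p [? ?]; apply Hf; split; lra. }
  assert (E2 : ex_RInt (contour_integrand f (x + l) y l) 0 l).
  { apply ex_RInt_contour_integrand; [lra|]. intros p [? ?]; apply Hf; split; lra. }
  assert (E3 : ex_RInt (contour_integrand f x (y + l) l) 0 l).
  { apply ex_RInt_contour_integrand; [lra|]. intros p [? ?]; apply Hf; split; lra. }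
  assert (E4 : ex_RInt (contour_integrand f (x + l) (y + l) l) 0 l).
  { apply ex_RInt_contour_integrand; [lra|]. intros p [? ?]; apply Hf; split; lra. }
  assert (E : ex_RInt (contour_integrand f x y (2 * l)) 0 (2 * l)).
  { apply ex_RInt_contour_integrand; [lra|]. easy. }
  assert (Ea : ex_RInt (contour_integrand f x y (2 * l)) 0 l).
  { apply (ex_RInt_Chasles_1 (V := R_CompleteNormedModule)) with (2 * l); [lra|easy]. }
  assert (Eb : ex_RInt (contour_integrand f x y (2 * l)) l (2 * l)).
  { apply (ex_RInt_Chasles_2 (V := R_CompleteNormedModule)) with 0; [lra|easy]. }
  assert (Eb' : ex_RInt (contour_integrand f x y (2 * l)) (1 * 0 + l) (1 * l + l)).
  { replace (1 * 0 + l) with l by ring. now replace (1 * l + l) with (2 * l) by ring. }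
  unfold contour_integral.
  rewrite <- (RInt_Chasles (V := R_CompleteNormedModule) _ 0 l (2 * l)) by easy.
  assert (S : RInt (contour_integrand f x y (2 * l)) l (2 * l) =
    RInt (fun t => contour_integrand f x y (2 * l) (t + l)) 0 l).
  { pose proof (RInt_comp_lin (V := R_CompleteNormedModule) (contour_integrand f x y (2 * l))
      1 l 0 l Eb') as H.
    replace (1 * 0 + l) with l in H by ring. replace (1 * l + l) with (2 * l) in H by ring.
    transitivity (RInt (fun t => scal 1 (contour_integrand f x y (2 * l) (1 * t + l))) 0 l).
    - symmetry; exact H.
    - apply (RInt_ext (V := R_CompleteNormedModule)). intros t _.
      change (1 * contour_integrand f x y (2 * l) (1 * t + l)
        = contour_integrand f x y (2 * l) (t + l)). now rewrite !Rmult_1_l. }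
  assert (Es : ex_RInt (fun t => contour_integrand f x y (2 * l) (t + l)) 0 l).
  { apply (ex_RInt_ext (V := R_NormedModule)
      (fun t => scal 1 (contour_integrand f x y (2 * l) (1 * t + l)))).
    - intros t _. change (1 * contour_integrand f x y (2 * l) (1 * t + l)
        = contour_integrand f x y (2 * l) (t + l)). now rewrite !Rmult_1_l.
    - now apply (ex_RInt_comp_lin (V := R_NormedModule)). }
  change plus with Rplus. rewrite S.
  change (RInt (contour_integrand f x y (2 * l)) 0 l
    + RInt (fun t => contour_integrand f x y (2 * l) (t + l)) 0 l =
    RInt (contour_integrand f x y l) 0 l + RInt (contour_integrand f (x + l) y l) 0 l
    + RInt (contour_integrand f x (y + l) l) 0 l + RInt (contour_integrand f (x + l) (y + l) l) 0 l).
  rewrite <- (RInt_plus (V := R_CompleteNormedModule) (contour_integrand f x y (2 * l))) by easy.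
  rewrite <- (RInt_plus (V := R_CompleteNormedModule) (contour_integrand f x y l)) by easy.
  pose proof (ex_RInt_plus (V := R_NormedModule) _ _ _ _ E1 E2) as E12.
  rewrite <- (RInt_plus (V := R_CompleteNormedModule) _ (contour_integrand f x (y + l) l)) by easy.
  pose proof (ex_RInt_plus (V := R_NormedModule) _ _ _ _ E12 E3) as E123.
  rewrite <- (RInt_plus (V := R_CompleteNormedModule) _ (contour_integrand f (x + l) (y + l) l)) by easy.
  apply (RInt_ext (V := R_CompleteNormedModule)). intros t _.
  unfold contour_integrand. change (@plus _) with Rplus.
  replace (x + l + l) with (x + 2 * l) by ring. replace (y + l + l) with (y + 2 * l) by ring.
  replace (x + l + t) with (x + (t + l)) by ring. replace (y + l + t) with (y + (t + l)) by ring.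
  match goal with |- ?a = ?b => change (@eq R a b) end. ring.
Qed.

Lemma contour_integral_bound (f : C -> C) (x y l K : R) :
  0 < l -> (forall p, in_square x y l p -> continuous_at f p) ->
  (forall z, square_boundary x y l z -> Cmod (f z) <= K) ->
  Rabs (contour_integral f x y l) <= 4 * K * l.
Proof.
  intros Hl Hf HK. replace (4 * K * l) with ((l - 0) * (4 * K)) by ring.
  apply abs_RInt_le_const; [lra|now apply ex_RInt_contour_integrand; [lra|]|].
  intros t Ht. unfold contour_integrand.
  assert (H1 : Rabs (Im (f (x + t, y))) <= K).
  { eapply Rle_trans; [apply Im_le_Cmod|]. apply HK. exists t; auto. }
  assert (H2 : Rabs (Im (f (x + t, y + l))) <= K).
  { eapply Rle_trans; [apply Im_le_Cmod|]. apply HK. exists t; auto. }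
  assert (H3 : Rabs (Re (f (x + l, y + t))) <= K).
  { eapply Rle_trans; [apply re_le_Cmod|]. apply HK. exists t; auto. }
  assert (H4 : Rabs (Re (f (x, y + t))) <= K).
  { eapply Rle_trans; [apply re_le_Cmod|]. apply HK. exists t; auto. }
  apply Rabs_le_between in H1, H2, H3, H4. apply Rabs_le. lra.
Qed.

Lemma contour_integrand_affine (f : C -> C) (a b : C) (x y l t : R) :
  contour_integrand (fun z => (f z - (a + b * z))%C) x y l t = contour_integrand f x y l t.
Proof.
  unfold contour_integrand, Re, Im, Cminus, Cplus, Copp, Cmult; simpl. ring.
Qed.

(** The bound eps * l^2 is additive like area, so it passes from quarters to the whole; on small
    squares it holds because subtracting the affine part of f at p leaves the integral unchanged and
    the integrand small. *)
Lemma goursat_square (f : C -> C) (x y l : R) :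
  0 < l -> (forall p, in_square x y l p -> differentiable_at f p) ->
  contour_integral f x y l = 0.
Proof.
  intros Hl Hf.
  assert (Hc : forall p, in_square x y l p -> continuous_at f p)
    by (intros; now apply differentiable_at_continuous, Hf).
  assert (Main : forall eps, 0 < eps -> Rabs (contour_integral f x y l) <= eps * (l * l)).
  { intros eps He.
    apply (square_induction (fun x' y' l' =>
      x <= x' /\ x' + l' <= x + l /\ y <= y' /\ y' + l' <= y + l ->
      Rabs (contour_integral f x' y' l') <= eps * (l' * l')) x y l Hl); [| |lra].
    - intros a b m Hm H1 H2 H3 H4 Hin.
      rewrite contour_integral_subdivide; [|easy|intros p [? ?]; apply Hc; split; lra].
      specialize (H1 ltac:(lra)). specialize (H2 ltac:(lra)). specialize (H3 ltac:(lra)).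
      specialize (H4 ltac:(lra)).
      apply Rabs_le_between in H1, H2, H3, H4. apply Rabs_le. nra.
    - intros p. destruct (classic (in_square x y l p)) as [Hp|Hp].
      + destruct (Hf p Hp) as [d Hd].
        (* On a square of side m around p, points lie within 2 m of p, so the remainder is at most
           eps m / 4, and the four sides together give eps m^2. *)
        destruct (derivative_at_approx f p d (eps / 8) Hd) as [del [Hdel H]]; [lra|].
        exists (del / 2). split; [lra|]. intros a b m Hm Hin Hsub.
        assert (Hcm : forall w, in_square a b m w -> continuous_at f w).
        { intros w [? ?]; apply Hc; split; lra. }
        set (g := fun z => (f z - ((f p - d * p) + d * z))%C).
        replace (contour_integral f a b m) with (contour_integral g a b m).
        * replace (eps * (m * m)) with (4 * (eps / 8 * (2 * m)) * m) by field.
          apply contour_integral_bound; [lra| |].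
          { intros w Hw. apply continuous_at_minus; [now apply Hcm|].
            apply continuous_at_plus; [apply continuous_at_const|].
            apply continuous_at_mult; [apply continuous_at_const|apply continuous_at_id]. }
          intros z Hz. apply square_boundary_in in Hz.
          pose proof (in_square_dist _ _ _ _ _ Hin Hz) as Dz.
          unfold g. replace (f z - (f p - d * p + d * z))%C with (f z - f p - d * (z - p))%C by ring.
          eapply Rle_trans; [apply H; lra|]. apply Rmult_le_compat_l; lra.
        * apply (RInt_ext (V := R_CompleteNormedModule)). intros t _.
          apply contour_integrand_affine.
      + exists 1. split; [lra|]. intros a b m Hm [Q1 Q2] Hs. destruct Hp. split; lra. }
  apply Rabs_eq_0. apply Rle_antisym; [|apply Rabs_pos].
  apply le_epsilon. intros eps He. rewrite Rplus_0_l.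
  replace eps with (eps / (l * l) * (l * l)) by (field; lra).
  apply Main. apply Rdiv_lt_0_compat; [easy|nra].
Qed.

(** * The maximum principle *)

(** Of the sixteen squares of side s, the twelve on the rim avoid the centre and contribute 0 by
    Goursat; the inner four form the square of side 2 s. *)
Lemma contour_integral_shrink (f : C -> C) (a b s : R) :
  0 < s ->
  (forall p, in_square (a - 2 * s) (b - 2 * s) (4 * s) p -> continuous_at f p) ->
  (forall p, in_square (a - 2 * s) (b - 2 * s) (4 * s) p -> p <> (a, b) -> differentiable_at f p) ->
  contour_integral f (a - 2 * s) (b - 2 * s) (4 * s) = contour_integral f (a - s) (b - s) (2 * s).
Proof.
  intros Hs Hc Hd.
  assert (Z : forall x y, (x = a - 2 * s \/ x = a - s \/ x = a \/ x = a + s) ->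
    (y = b - 2 * s \/ y = b - s \/ y = b \/ y = b + s) ->
    (x = a - 2 * s \/ x = a + s \/ y = b - 2 * s \/ y = b + s) ->
    contour_integral f x y s = 0).
  { intros x y Hx Hy Ho. apply goursat_square; [easy|]. intros p [P1 P2]. apply Hd.
    - split; lra.
    - intros ->. simpl in *. lra. }
  replace (4 * s) with (2 * (2 * s)) in * by ring.
  rewrite (contour_integral_subdivide f (a - 2 * s) (b - 2 * s) (2 * s)); [|lra|easy].
  rewrite !(contour_integral_subdivide f _ _ s);
    try (easy || (intros p [? ?]; apply Hc; split; lra)).
  replace (a - 2 * s + 2 * s) with a by ring. replace (b - 2 * s + 2 * s) with b by ring.
  replace (a - 2 * s + s) with (a - s) by ring. replace (b - 2 * s + s) with (b - s) by ring.
  replace (a - s + s) with a by ring. replace (b - s + s) with b by ring.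
  rewrite (Z (a - 2 * s) (b - 2 * s)), (Z (a - s) (b - 2 * s)), (Z (a - 2 * s) (b - s)),
    (Z a (b - 2 * s)), (Z (a + s) (b - 2 * s)), (Z (a + s) (b - s)),
    (Z (a - 2 * s) b), (Z (a - 2 * s) (b + s)), (Z (a - s) (b + s)),
    (Z (a + s) b), (Z a (b + s)), (Z (a + s) (b + s)) by tauto.
  ring.
Qed.

(** Halving the square about its centre preserves the integral, while boundedness of f makes it tend
    to 0 with the side. *)
Lemma contour_integral_removable (f : C -> C) (a b r : R) :
  0 < r ->
  (forall p, in_square (a - r) (b - r) (2 * r) p -> continuous_at f p) ->
  (forall p, in_square (a - r) (b - r) (2 * r) p -> p <> (a, b) -> differentiable_at f p) ->
  contour_integral f (a - r) (b - r) (2 * r) = 0.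
Proof.
  intros Hr Hc Hd.
  assert (Hn : forall n, 0 < r * (/ 2) ^ n <= r).
  { intros n. assert (0 < (/ 2) ^ n) by (apply pow_lt; lra).
    assert ((/ 2) ^ n <= 1); [|nra]. rewrite <- (pow1 n). apply pow_incr; lra. }
  assert (S : forall n, contour_integral f (a - r) (b - r) (2 * r) =
    contour_integral f (a - r * (/ 2) ^ n) (b - r * (/ 2) ^ n) (2 * (r * (/ 2) ^ n))).
  { induction n as [|n IH].
    - simpl. now rewrite Rmult_1_r.
    - rewrite IH. specialize (Hn n). set (s := r * (/ 2) ^ S n).
      assert (E : r * (/ 2) ^ n = 2 * s) by (unfold s; simpl; field).
      rewrite E in *. replace (2 * (2 * s)) with (4 * s) by ring.
      apply contour_integral_shrink; [lra| |]; intros p [? ?].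
      + apply Hc. split; lra.
      + apply Hd. split; lra. }
  destruct (max_on_square (fun z => Cmod (f z)) (a - r) (b - r) (2 * r)) as [p [Hp HK]]; [lra| |].
  { intros q Hq. apply (continuous_at_comp f (fun w => RtoC (Cmod w))).
    - now apply Hc.
    - apply continuous_at_Cmod. }
  set (K := Cmod (f p)) in *. assert (HK0 : 0 <= K) by apply Cmod_ge_0.
  apply Rabs_eq_0. apply Rle_antisym; [|apply Rabs_pos].
  apply le_epsilon. intros eps He. rewrite Rplus_0_l.
  (* The N-th square has side 2 r / 2^N, so its integral is at most 8 K r / 2^N; K + 1 keeps the
     denominator positive. *)
  destruct (pow_lt_1_zero (/ 2)) with (y := eps / (8 * (K + 1) * r)) as [N HN].
  { rewrite Rabs_pos_eq; lra. }
  { apply Rdiv_lt_0_compat; nra. }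
  specialize (HN N (le_n _)). specialize (Hn N). rewrite (S N).
  rewrite Rabs_pos_eq in HN by (apply pow_le; lra).
  apply (Rmult_lt_compat_l (8 * (K + 1) * r)) in HN; [|nra].
  replace (8 * (K + 1) * r * (eps / (8 * (K + 1) * r))) with eps in HN by (field; lra).
  eapply Rle_trans; [apply (contour_integral_bound f _ _ _ K)|].
  - lra.
  - intros q [? ?]. apply Hc. split; lra.
  - intros z Hz. apply square_boundary_in in Hz as [? ?]. apply HK. split; lra.
  - nra.
Qed.

Lemma Cmod_ge_Re (z : C) (r : R) : r <= Rabs (Re z) -> r <= Cmod z.
Proof. intros H. eapply Rle_trans; [exact H|apply re_le_Cmod]. Qed.

Lemma Cmod_ge_Im (z : C) (r : R) : r <= Rabs (Im z) -> r <= Cmod z.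
Proof. intros H. eapply Rle_trans; [exact H|apply Im_le_Cmod]. Qed.

(* Cauchy's formula for f / (z - z0) with the crude lower bound 4 for the winding
   integral; the constant is irrelevant because it disappears on taking powers of f. *)
Lemma boundary_bound_ge_half (f : C -> C) (a b r M : R) :
  0 < r ->
  (forall p, in_square (a - r) (b - r) (2 * r) p -> differentiable_at f p) ->
  f (a, b) = RtoC 1 ->
  (forall z, square_boundary (a - r) (b - r) (2 * r) z -> Cmod (f z) <= M) ->
  / 2 <= M.
Proof.
  intros Hr Hf H1 HM. apply Rnot_lt_le. intros Hlt.
  set (z0 := (a, b) : C) in *.
  destruct (Hf z0) as [d Hd]; [split; simpl; lra|].
  (* Since f z0 = 1, this quotient extends continuously by d; its integral then vanishes, which
     compares f / (z - z0) with 1 / (z - z0). *)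
  set (k := fun z => if Ceq_dec z z0 then d else ((f z - 1) * / (z - z0))%C).
  assert (Hk : forall z, z <> z0 -> k z = ((f z - 1) * / (z - z0))%C).
  { intros z Hz. unfold k. now destruct (Ceq_dec z z0). }
  assert (Dk : forall p, in_square (a - r) (b - r) (2 * r) p -> p <> z0 -> differentiable_at k p).
  { intros p Hp Np.
    apply (differentiable_at_local (fun z => ((f z - 1) * / (z - z0))%C) k p (Cmod (p - z0)%C)).
    - now apply Cmod_gt_0, Cminus_eq_contra.
    - intros w Hw. symmetry. apply Hk. intros ->. rewrite Cmod_sub_sym in Hw. lra.
    - apply (differentiable_at_mult (fun z => (f z - 1)%C)).
      + apply differentiable_at_minus; [now apply Hf|apply differentiable_at_const].
      + apply (differentiable_at_inv (fun z => (z - z0)%C)).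
        * apply differentiable_at_minus; [apply differentiable_at_id|apply differentiable_at_const].
        * now apply Cminus_eq_contra. }
  assert (Ck : forall p, in_square (a - r) (b - r) (2 * r) p -> continuous_at k p).
  { intros p Hp. destruct (Ceq_dec p z0) as [->|Np].
    - destruct Hd as [q [Hq [Eq [del [Hdel Hqf]]]]].
      apply (continuous_at_local q k z0 del Hdel); [|easy]. intros w Hw.
      unfold k. destruct (Ceq_dec w z0) as [->|Nw]; [easy|].
      rewrite <- H1, Hqf by easy. field. now apply Cminus_eq_contra.
    - now apply differentiable_at_continuous, Dk. }
  pose proof (contour_integral_removable k a b r Hr Ck Dk) as HJ.
  (* On each side, f / (z - z0) contributes at most M / r and - 1 / (z - z0) at most - 1 / (2 r).
     For M < 1 / 2 the integral would be negative, yet it is 0. *)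
  assert (Hle : contour_integral k (a - r) (b - r) (2 * r) <= RInt (fun _ => 4 * (M - / 2) / r) 0 (2 * r)).
  { apply RInt_le; [lra| | |].
    - apply ex_RInt_contour_integrand; [lra|easy].
    - apply (ex_RInt_const (V := R_NormedModule)).
    - assert (Inv : forall X Y : R, 0 < X * X + Y * Y ->
        (/ (X, Y))%C = (X / (X * X + Y * Y), - Y / (X * X + Y * Y))).
      { intros X Y HXY. unfold Cinv; simpl. now rewrite !Rmult_1_r. }
      intros t Ht. set (X := t - r).
      assert (HX : X * X <= r * r) by (unfold X; nra).
      assert (Hh : / (2 * r) <= r / (X * X + r * r)).
      { assert (HS : 0 < X * X + r * r) by nra.
        apply Rmult_le_reg_r with (2 * r * (X * X + r * r)); [apply Rmult_lt_0_compat; lra|].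
        replace (/ (2 * r) * (2 * r * (X * X + r * r))) with (X * X + r * r) by (field; lra).
        replace (r / (X * X + r * r) * (2 * r * (X * X + r * r))) with (2 * (r * r)) by (field; lra).
        lra. }
      assert (Bd : forall z, square_boundary (a - r) (b - r) (2 * r) z -> r <= Cmod (z - z0)%C ->
        z <> z0 /\ Cmod (f z * / (z - z0))%C <= M / r).
      { intros z Hz Hrz. assert (Nz : z <> z0).
        { intros ->. rewrite Cmod_sub_diag in Hrz. lra. }
        split; [easy|]. rewrite Cmod_mult, Cmod_inv by now apply Cminus_eq_contra.
        apply Rmult_le_compat; [apply Cmod_ge_0| |now apply HM|].
        - left; apply Rinv_0_lt_compat; lra.
        - now apply Rinv_le_contravar. }
      assert (P : forall z, z <> z0 -> k z = (f z * / (z - z0) - / (z - z0))%C).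
      { intros z Hz. rewrite Hk by easy. ring. }
      assert (Hb : Im (k (a - r + t, b - r)) <= M / r - / (2 * r)).
      { destruct (Bd (a - r + t, b - r)) as [Nz Bz].
        - exists t. split; [lra|tauto].
        - apply Cmod_ge_Im. simpl. rewrite Rabs_left1; lra.
        - rewrite P by easy. eapply Rle_trans in Bz; [|apply Im_le_Cmod].
          apply Rabs_le_between in Bz. unfold Cminus at 1.
          rewrite im_plus, im_opp.
          replace ((a - r + t, b - r)%R - z0)%C with (X, - r) in *
            by (unfold X, z0, Cminus, Cplus, Copp; simpl; f_equal; ring).
          assert (J : Im (/ (X, (- r)%R))%C = r / (X * X + r * r))
            by (rewrite Inv by nra; simpl; field; nra).
          rewrite J. lra. }
      assert (Ht' : - Im (k (a - r + t, b - r + 2 * r)) <= M / r - / (2 * r)).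
      { destruct (Bd (a - r + t, b - r + 2 * r)) as [Nz Bz].
        - exists t. split; [lra|tauto].
        - apply Cmod_ge_Im. simpl. rewrite Rabs_pos_eq; lra.
        - rewrite P by easy. eapply Rle_trans in Bz; [|apply Im_le_Cmod].
          apply Rabs_le_between in Bz. unfold Cminus at 1.
          rewrite im_plus, im_opp.
          replace ((a - r + t, b - r + 2 * r)%R - z0)%C with (X, r) in *
            by (unfold X, z0, Cminus, Cplus, Copp; simpl; f_equal; ring).
          assert (J : Im (/ (X, r))%C = - (r / (X * X + r * r)))
            by (rewrite Inv by nra; simpl; field; nra).
          rewrite J. lra. }
      assert (Hri : Re (k (a - r + 2 * r, b - r + t)) <= M / r - / (2 * r)).
      { destruct (Bd (a - r + 2 * r, b - r + t)) as [Nz Bz].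
        - exists t. split; [lra|tauto].
        - apply Cmod_ge_Re. simpl. rewrite Rabs_pos_eq; lra.
        - rewrite P by easy. eapply Rle_trans in Bz; [|apply re_le_Cmod].
          apply Rabs_le_between in Bz. unfold Cminus at 1.
          rewrite re_plus, re_opp.
          replace ((a - r + 2 * r, b - r + t)%R - z0)%C with (r, X) in *
            by (unfold X, z0, Cminus, Cplus, Copp; simpl; f_equal; ring).
          assert (J : Re (/ (r, X))%C = r / (X * X + r * r))
            by (rewrite Inv by nra; simpl; field; nra).
          rewrite J. lra. }
      assert (Hle : - Re (k (a - r, b - r + t)) <= M / r - / (2 * r)).
      { destruct (Bd (a - r, b - r + t)) as [Nz Bz].
        - exists t. split; [lra|tauto].
        - apply Cmod_ge_Re. simpl. rewrite Rabs_left1; lra.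
        - rewrite P by easy. eapply Rle_trans in Bz; [|apply re_le_Cmod].
          apply Rabs_le_between in Bz. unfold Cminus at 1.
          rewrite re_plus, re_opp.
          replace ((a - r, b - r + t)%R - z0)%C with (- r, X) in *
            by (unfold X, z0, Cminus, Cplus, Copp; simpl; f_equal; ring).
          assert (J : Re (/ ((- r)%R, X))%C = - (r / (X * X + r * r)))
            by (rewrite Inv by nra; simpl; field; nra).
          rewrite J. lra. }
      replace (4 * (M - / 2) / r) with (4 * (M / r - / (2 * r))) by (field; lra).
      unfold contour_integrand. lra. }
  rewrite HJ, (RInt_const (V := R_CompleteNormedModule)) in Hle.
  change (0 <= (2 * r - 0) * (4 * (M - / 2) / r)) in Hle.
  replace ((2 * r - 0) * (4 * (M - / 2) / r)) with (8 * (M - / 2)) in Hle by (field; lra).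
  lra.
Qed.

(** By compactness |f| <= m < 1 on the boundary, so a high power of f is still 1 at the centre but
    below 1 / 2 on the boundary. *)
Lemma max_modulus_square (f : C -> C) (z0 : C) (r : R) :
  0 < r ->
  (forall p, in_square (Re z0 - r) (Im z0 - r) (2 * r) p -> differentiable_at f p) ->
  f z0 = RtoC 1 ->
  (forall z, square_boundary (Re z0 - r) (Im z0 - r) (2 * r) z -> Cmod (f z) < 1) ->
  False.
Proof.
  intros Hr Hf H1 Hb.
  destruct (square_boundary_lower_bound (fun z => 1 - Cmod (f z)) (Re z0 - r) (Im z0 - r) (2 * r))
    as [eta [He H]]; [lra| |].
  { intros z Hz. split; [|specialize (Hb z Hz); lra].
    apply (continuous_at_local (fun z => (1 - RtoC (Cmod (f z)))%C) _ z 1); [lra| |].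
    - intros w _. symmetry; apply RtoC_minus.
    - apply continuous_at_minus; [apply continuous_at_const|].
      apply (continuous_at_comp f (fun w => RtoC (Cmod w))); [|apply continuous_at_Cmod].
      apply differentiable_at_continuous, Hf. now apply square_boundary_in. }
  set (m := Rmax (1 - eta) 0).
  assert (Hm : 0 <= m < 1).
  { unfold m. split; [apply Rmax_r|]. apply Rmax_lub_lt; lra. }
  destruct (pow_lt_1_zero m) with (y := / 2) as [N HN].
  { rewrite Rabs_pos_eq; lra. }
  { lra. }
  specialize (HN N (le_n _)). rewrite Rabs_pos_eq in HN by (apply pow_le; lra).
  apply (Rlt_not_le _ _ HN).
  apply (boundary_bound_ge_half (fun z => (f z ^ N)%C) (Re z0) (Im z0) r); [easy| | |].
  - intros p Hp. now apply differentiable_at_pow, Hf.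
  - replace (Re z0, Im z0) with z0 by now destruct z0. rewrite H1. apply Cpow_1_l.
  - intros z Hz. rewrite Cmod_pow. apply pow_incr. split; [apply Cmod_ge_0|].
    specialize (H z Hz). eapply Rle_trans; [|apply Rmax_l]. lra.
Qed.

(** Real parts become moduli after adding a large constant: with k = f - f z0, |1 + k / N|^2 = 1 +
    (2 N Re k + |k|^2) / N^2, which is below 1 on the boundary for large N. *)
Lemma max_Re_square (f : C -> C) (z0 : C) (r : R) :
  0 < r ->
  (forall p, in_square (Re z0 - r) (Im z0 - r) (2 * r) p -> differentiable_at f p) ->
  (forall z, square_boundary (Re z0 - r) (Im z0 - r) (2 * r) z -> Re (f z) < Re (f z0)) ->
  False.
Proof.
  intros Hr Hf Hb.
  assert (Ck : forall p, in_square (Re z0 - r) (Im z0 - r) (2 * r) p ->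
    continuous_at (fun z => (f z - f z0)%C) p).
  { intros p Hp. apply continuous_at_minus; [|apply continuous_at_const].
    now apply differentiable_at_continuous, Hf. }
  destruct (square_boundary_lower_bound (fun z => - Re (f z - f z0)) (Re z0 - r) (Im z0 - r) (2 * r))
    as [eta [He H]]; [lra| |].
  { intros z Hz. split.
    - apply (continuous_at_local (fun z => (0 - RtoC (Re (f z - f z0)))%C) _ z 1); [lra| |].
      + intros w _. rewrite <- RtoC_minus. f_equal. ring.
      + apply continuous_at_minus; [apply continuous_at_const|].
        apply (continuous_at_comp (fun z => (f z - f z0)%C) (fun w => RtoC (Re w)));
          [|apply continuous_at_Re].
        now apply Ck, square_boundary_in.
    - specialize (Hb z Hz). unfold Cminus. rewrite re_plus, re_opp. lra. }
  destruct (max_on_square (fun z => Cmod (f z - f z0)%C) (Re z0 - r) (Im z0 - r) (2 * r))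
    as [p [Hp HK]]; [lra| |].
  { intros q Hq. apply (continuous_at_comp (fun z => (f z - f z0)%C) (fun w => RtoC (Cmod w)));
      [now apply Ck|apply continuous_at_Cmod]. }
  set (B := Cmod (f p - f z0)%C) in *. assert (B0 : 0 <= B) by apply Cmod_ge_0.
  (* On the boundary Re k <= - eta and |k| <= B; this N gives 2 eta N = B^2 + 1 > B^2. *)
  set (N := (B * B + 1) / (2 * eta)).
  assert (HN : 0 < N) by (apply Rdiv_lt_0_compat; nra).
  assert (EN : 2 * eta * N = B * B + 1) by (unfold N; field; lra).
  apply (max_modulus_square (fun z => (1 + RtoC (/ N) * (f z - f z0))%C) z0 r); [easy| | |].
  - intros q Hq. apply differentiable_at_plus; [apply differentiable_at_const|].
    apply differentiable_at_mult; [apply differentiable_at_const|].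
    apply differentiable_at_minus; [now apply Hf|apply differentiable_at_const].
  - ring.
  - intros z Hz. specialize (H z Hz). cbv beta in H.
    assert (HB : Cmod (f z - f z0)%C <= B) by now apply HK, square_boundary_in.
    pose proof (Cmod_ge_0 (f z - f z0)%C) as H0.
    set (k := (f z - f z0)%C) in *.
    assert (Sq : Cmod (1 + RtoC (/ N) * k)%C ^ 2 < 1 ^ 2).
    { rewrite Cmod2_alt, re_plus, re_scal_l, im_plus, im_scal_l, im_RtoC, re_RtoC.
      assert (Ek : Cmod k ^ 2 = Re k ^ 2 + Im k ^ 2) by apply Cmod2_alt.
      assert (Bk : Cmod k ^ 2 <= B * B) by nra.
      replace ((1 + / N * Re k) ^ 2 + (0 + / N * Im k) ^ 2)
        with (1 + (2 * Re k * N + Cmod k ^ 2) * (/ N * / N)) by (rewrite Ek; field; lra).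
      assert (0 < / N) by now apply Rinv_0_lt_compat.
      assert (Re k * N <= - eta * N) by (apply Rmult_le_compat_r; lra).
      nra. }
    apply Rnot_le_lt. intros Hge. apply (Rlt_not_le _ _ Sq). apply pow_incr; split; [lra|exact Hge].
Qed.

(** * Consequences of the maximum principle *)

Lemma centered_square_in_ball (z0 z : C) (r : R) :
  in_square (Re z0 - r) (Im z0 - r) (2 * r) z -> Cmod (z - z0)%C <= 2 * r.
Proof.
  intros [H1 H2]. eapply Rle_trans; [apply Cmod_le_Re_Im|].
  unfold Cminus. rewrite re_plus, re_opp, im_plus, im_opp.
  assert (Rabs (Re z + - Re z0) <= r) by (apply Rabs_le; lra).
  assert (Rabs (Im z + - Im z0) <= r) by (apply Rabs_le; lra). lra.
Qed.

Lemma square_boundary_center (z0 : C) (r : R) :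
  0 < r -> ~ square_boundary (Re z0 - r) (Im z0 - r) (2 * r) z0.
Proof.
  intros Hr [t [Ht H]]. destruct z0 as [a b]; unfold Re, Im in H; simpl in H.
  destruct H as [H|[H|[H|H]]]; injection H; lra.
Qed.

Lemma strict_local_max_Re_absurd (f : C -> C) (z0 : C) (del : R) :
  0 < del ->
  (forall z, Cmod (z - z0)%C < del -> differentiable_at f z) ->
  (forall z, Cmod (z - z0)%C < del -> z <> z0 -> Re (f z) < Re (f z0)) ->
  False.
Proof.
  intros Hd Hf Hm. apply (max_Re_square f z0 (del / 4)); [lra| |].
  - intros p Hp. apply Hf. apply centered_square_in_ball in Hp. lra.
  - intros z Hz. apply Hm.
    + apply square_boundary_in, centered_square_in_ball in Hz. lra.
    + intros ->. apply square_boundary_center in Hz; [easy|lra].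
Qed.

(** If f omitted w, then (f z0 - w) / (f z - w) would be holomorphic, equal to 1 at z0, and of
    modulus below 1 on a boundary where |f z - f z0| >= m, as soon as |w - f z0| < m / 2. *)
Lemma open_at_isolated_value (f : C -> C) (z0 : C) (del : R) :
  0 < del ->
  (forall z, Cmod (z - z0)%C < del -> differentiable_at f z) ->
  (forall z, Cmod (z - z0)%C < del -> z <> z0 -> f z <> f z0) ->
  exists eta, 0 < eta /\ forall w, Cmod (w - f z0)%C < eta ->
    exists z, Cmod (z - z0)%C < del /\ f z = w.
Proof.
  intros Hd Hf Hi. set (r := del / 4).
  assert (Hball : forall z, in_square (Re z0 - r) (Im z0 - r) (2 * r) z -> Cmod (z - z0)%C < del).
  { intros z Hz. apply centered_square_in_ball in Hz. unfold r in Hz. lra. }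
  destruct (square_boundary_lower_bound (fun z => Cmod (f z - f z0)%C)
    (Re z0 - r) (Im z0 - r) (2 * r)) as [m [Hm H]]; [unfold r; lra| |].
  { intros z Hz. pose proof (Hball z (square_boundary_in _ _ _ _ Hz)) as Bz. split.
    - apply (continuous_at_comp (fun z => (f z - f z0)%C) (fun w => RtoC (Cmod w)));
        [|apply continuous_at_Cmod].
      apply continuous_at_minus; [|apply continuous_at_const].
      now apply differentiable_at_continuous, Hf.
    - apply Cmod_gt_0, Cminus_eq_contra, Hi; [easy|].
      intros ->. apply square_boundary_center in Hz; [easy|unfold r; lra]. }
  exists (m / 2). split; [lra|]. intros w Hw. apply NNPP. intros Hno.
  assert (Nw : forall z, Cmod (z - z0)%C < del -> (f z - w)%C <> RtoC 0).
  { intros z Hz E. apply Hno. exists z. split; [easy|]. now apply Ceq_minus. }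
  apply (max_modulus_square (fun z => ((f z0 - w) * / (f z - w))%C) z0 r); [unfold r; lra| | |].
  - intros p Hp. apply differentiable_at_mult; [apply differentiable_at_const|].
    apply (differentiable_at_inv (fun z => (f z - w)%C)).
    + apply differentiable_at_minus; [now apply Hf, Hball|apply differentiable_at_const].
    + now apply Nw, Hball.
  - apply Cinv_r, Nw. rewrite Cmod_sub_diag. lra.
  - intros z Hz. specialize (H z Hz). cbv beta in H.
    pose proof (Nw z (Hball z (square_boundary_in _ _ _ _ Hz))) as Nz.
    rewrite Cmod_mult, Cmod_inv by easy. apply Cmod_gt_0 in Nz.
    apply Rmult_lt_reg_r with (Cmod (f z - w)%C); [easy|].
    rewrite Rmult_assoc, Rinv_l by lra.
    pose proof (Cmod_sub_triangle (f z) w (f z0)). rewrite (Cmod_sub_sym (f z0) w). lra.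
Qed.

(** Some direction would change Re f at rate |d|; as Re f does not change, the error term of the
    first-order expansion forces |d| <= eps. *)
Lemma derivative_zero_of_constant_Re (f : C -> C) (z : C) (M r : R) :
  0 < r -> differentiable_at f z ->
  (forall w, Cmod (w - z)%C < r -> Re (f w) = M) -> derivative_at f z 0.
Proof.
  intros Hr [d Hd] HM. replace (RtoC 0) with d; [easy|].
  apply Cmod_eq_0. apply Rle_antisym; [|apply Cmod_ge_0].
  apply le_epsilon. intros eps He. rewrite Rplus_0_l.
  destruct (derivative_at_approx f z d eps Hd He) as [s [Hs H]].
  destruct (Req_dec (Cmod d) 0) as [E|E]; [lra|].
  pose proof (Cmod_ge_0 d) as Pd. assert (P : 0 < Cmod d) by lra.
  (* Moving in the direction of the conjugate of d makes d * (w - z) real. *)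
  set (t := Rmin r s / (2 * Cmod d)). assert (Hm : 0 < Rmin r s) by now apply Rmin_pos.
  assert (Ht : 0 < t) by (apply Rdiv_lt_0_compat; lra).
  set (w := (z + RtoC t * Cconj d)%C).
  assert (Ew : (w - z)%C = (RtoC t * Cconj d)%C) by (unfold w; ring).
  assert (Dw : Cmod (w - z)%C = t * Cmod d).
  { rewrite Ew, Cmod_mult, Cmod_R, Cmod_conj, Rabs_pos_eq; lra. }
  assert (Etd : t * Cmod d = Rmin r s / 2) by (unfold t; field; lra).
  pose proof (Rmin_l r s). pose proof (Rmin_r r s).
  specialize (H w ltac:(lra)).
  assert (Hw : Re (f w) = M) by (apply HM; lra).
  assert (Hz : Re (f z) = M) by (apply HM; rewrite Cmod_sub_diag; lra).
  assert (Er : Re (f w - f z - d * (w - z)) = - (t * Cmod d ^ 2)).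
  { unfold Cminus at 1 2. rewrite re_plus, re_opp, re_plus, re_opp, Hw, Hz, Ew.
    replace (d * (RtoC t * Cconj d))%C with (RtoC t * (d * Cconj d))%C by ring.
    rewrite <- Cmod2_conj, re_scal_l.
    replace (RtoC (Cmod d) ^ 2)%C with (RtoC (Cmod d ^ 2)).
    - rewrite re_RtoC. ring.
    - simpl. now rewrite !RtoC_mult. }
  pose proof (Rle_trans _ _ _ (re_le_Cmod _) H) as H'. rewrite Er, Dw, Rabs_Ropp in H'.
  rewrite Rabs_pos_eq in H' by nra.
  apply Rmult_le_reg_r with (t * Cmod d); [nra|]. nra.
Qed.

(** Along the radius t z, 0 <= t <= 1, the real and imaginary parts of f are real functions with
    zero derivative. *)
Lemma derivative_zero_on_disc (f : C -> C) :
  (forall z, unit_disc z -> derivative_at f z 0) ->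
  forall z, unit_disc z -> f z = f 0%C.
Proof.
  intros Hf z Hz.
  assert (Hstep : forall t eps, 0 <= t <= 1 -> 0 < eps -> exists del : posreal,
    forall h : R, h <> 0 -> Rabs h < del ->
      Cmod (f (RtoC (t + h) * z) - f (RtoC t * z))%C < eps * Rabs h).
  { intros t eps Ht He. unfold unit_disc in Hz. pose proof (Cmod_ge_0 z).
    destruct (derivative_at_approx f (RtoC t * z)%C 0 (eps / 2)) as [del [Hd H']]; [|lra|].
    - apply Hf. unfold unit_disc. rewrite Cmod_mult, Cmod_R, Rabs_pos_eq; nra.
    - exists (mkposreal del Hd). intros h Hh Hhd. simpl in Hhd.
      apply Rabs_pos_lt in Hh.
      assert (E : Cmod (RtoC (t + h) * z - RtoC t * z)%C = Rabs h * Cmod z).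
      { replace (RtoC (t + h) * z - RtoC t * z)%C with (RtoC h * z)%C
          by (rewrite RtoC_plus; ring). now rewrite Cmod_mult, Cmod_R. }
      specialize (H' (RtoC (t + h) * z)%C). rewrite E in H'.
      specialize (H' ltac:(nra)).
      match type of H' with Cmod ?a <= _ =>
        replace a with (f (RtoC (t + h) * z) - f (RtoC t * z))%C in H' by ring end.
      assert (Rabs h * Cmod z <= Rabs h) by nra.
      assert (eps / 2 * (Rabs h * Cmod z) <= eps / 2 * Rabs h) by (apply Rmult_le_compat_l; lra).
      nra. }
  assert (HR : Re (f (RtoC 0 * z)%C) = Re (f (RtoC 1 * z)%C)).
  { apply (eq_is_derive (V := R_NormedModule) (fun t => Re (f (RtoC t * z)%C)) 0 1); [|lra].
    intros t Ht. apply is_derive_Reals. intros eps He.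
    destruct (Hstep t eps Ht He) as [del H]. exists del. intros h Hh Hhd.
    specialize (H h Hh Hhd). change zero with 0. rewrite Rminus_0_r.
    unfold Rdiv. rewrite Rabs_mult, Rabs_inv. apply Rabs_pos_lt in Hh.
    apply Rmult_lt_reg_r with (Rabs h); [easy|]. rewrite Rmult_assoc, Rinv_l by lra.
    rewrite Rmult_1_r. eapply Rle_lt_trans; [|exact H].
    eapply Rle_trans; [|apply re_le_Cmod]. right; reflexivity. }
  assert (HI : Im (f (RtoC 0 * z)%C) = Im (f (RtoC 1 * z)%C)).
  { apply (eq_is_derive (V := R_NormedModule) (fun t => Im (f (RtoC t * z)%C)) 0 1); [|lra].
    intros t Ht. apply is_derive_Reals. intros eps He.
    destruct (Hstep t eps Ht He) as [del H]. exists del. intros h Hh Hhd.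
    specialize (H h Hh Hhd). change zero with 0. rewrite Rminus_0_r.
    unfold Rdiv. rewrite Rabs_mult, Rabs_inv. apply Rabs_pos_lt in Hh.
    apply Rmult_lt_reg_r with (Rabs h); [easy|]. rewrite Rmult_assoc, Rinv_l by lra.
    rewrite Rmult_1_r. eapply Rle_lt_trans; [|exact H].
    eapply Rle_trans; [|apply Im_le_Cmod]. right; reflexivity. }
  rewrite Cmult_0_l, Cmult_1_l in HR, HI.
  destruct (f z), (f 0%C). unfold Re, Im in *. simpl in *. now subst.
Qed.

(** * Periods *)

Lemma periodic_IZR {T : Type} (F : C -> T) (a : C) :
  (forall w, F (w + a)%C = F w) -> forall (n : Z) w, F (w + RtoC (IZR n) * a)%C = F w.
Proof.
  intros H.
  assert (Hn : forall (n : nat) w, F (w + RtoC (INR n) * a)%C = F w).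
  { induction n as [|n IH]; intros w.
    - simpl. f_equal. ring.
    - rewrite <- (IH w), <- (H (w + RtoC (INR n) * a)%C). f_equal.
      rewrite S_INR, RtoC_plus. ring. }
  intros n w. destruct n as [|p|p].
  - f_equal. ring.
  - rewrite <- positive_nat_Z, <- INR_IZR_INZ. apply Hn.
  - rewrite <- (Hn (Pos.to_nat p)). f_equal.
    change (Z.neg p) with (- Z.pos p)%Z. rewrite <- positive_nat_Z, opp_IZR, <- INR_IZR_INZ, RtoC_opp.
    ring.
Qed.

Lemma floor_exists (x : R) : exists n : Z, 0 <= x - IZR n < 1.
Proof.
  exists (up x - 1)%Z. rewrite minus_IZR. destruct (archimed x). lra.
Qed.

(* If t is a small element, so is one of 1 - k t and (k + 1) t - 1 with k = floor (1 / t),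
   and that one is at most t / 2. *)
Lemma small_elements_of_subgroup (P : R -> Prop) (c : R) :
  P 1 -> P c -> (forall s t, P s -> P t -> P (s - t)) ->
  (forall m n : Z, n <> 0%Z -> IZR n * c <> IZR m) ->
  forall eps, 0 < eps -> exists t, 0 < t < eps /\ P t.
Proof.
  intros P1 Pc Psub Hc.
  assert (P0 : P 0) by (replace 0 with (1 - 1) by ring; auto).
  assert (Popp : forall t, P t -> P (- t)) by (intros; replace (- t) with (0 - t) by ring; auto).
  assert (Padd : forall s t, P s -> P t -> P (s + t)).
  { intros. replace (s + t) with (s - - t) by ring. auto. }
  assert (Pn : forall (n : nat) t, P t -> P (INR n * t)).
  { induction n; intros t Ht; [now rewrite Rmult_0_l|].
    rewrite S_INR, Rmult_plus_distr_r, Rmult_1_l. auto. }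
  assert (PZ : forall (n : Z) t, P t -> P (IZR n * t)).
  { intros [|p|p] t Ht.
    - now rewrite Rmult_0_l.
    - rewrite <- positive_nat_Z, <- INR_IZR_INZ. auto.
    - change (Z.neg p) with (- Z.pos p)%Z.
      rewrite <- positive_nat_Z, opp_IZR, <- INR_IZR_INZ, Ropp_mult_distr_l_reverse. auto. }
  (* Irrationality of t belongs to the invariant: it keeps the remainder 1 - n t of the next step
     from being 0. *)
  assert (Main : forall k : nat, exists t, 0 < t < (/ 2) ^ k /\ P t /\
    forall m n : Z, n <> 0%Z -> IZR n * t <> IZR m).
  { induction k as [|k [t [Ht [Pt It]]]].
    - destruct (floor_exists c) as [n Hn]. exists (c - IZR n).
      assert (c - IZR n <> 0).
      { intros E. apply (Hc n 1%Z); [easy|]. lra. }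
      split; [simpl; lra|]. split.
      + apply Psub; [easy|]. rewrite <- (Rmult_1_r (IZR n)). auto.
      + intros m j Hj E. apply (Hc (m + j * n)%Z j Hj). rewrite plus_IZR, mult_IZR. lra.
    - assert (Ht1 : t < 1).
      { assert ((/ 2) ^ k <= 1); [|lra]. rewrite <- (pow1 k). apply pow_incr. lra. }
      destruct (floor_exists (/ t)) as [n [Hn1 Hn2]].
      assert (Hi : t * / t = 1) by (apply Rinv_r; lra).
      assert (Hit : 1 < / t) by (rewrite <- Rinv_1; apply Rinv_lt_contravar; lra).
      assert (n0 : 0 < IZR n) by lra.
      assert (n0' : (0 < n)%Z) by now apply lt_IZR.
      assert (Hle : IZR n * t <= 1) by nra.
      assert (Hlt : 1 < (IZR n + 1) * t) by nra.
      assert (Hne : IZR n * t <> 1) by (apply (It 1%Z n); lia).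
      destruct (Rle_dec (1 - IZR n * t) (t / 2)) as [L|L].
      + exists (1 - IZR n * t). split; [simpl; lra|]. split; [auto|].
        intros m j Hj E. apply (It (j - m)%Z (j * n)%Z); [lia|].
        rewrite minus_IZR, mult_IZR. lra.
      + exists ((IZR n + 1) * t - 1). split; [simpl; lra|]. split.
        * apply Psub; [|easy]. rewrite <- plus_IZR. auto.
        * intros m j Hj E. apply (It (m + j)%Z (j * (n + 1))%Z); [lia|].
          rewrite mult_IZR, !plus_IZR. lra. }
  intros eps He. destruct (pow_lt_1_zero (/ 2)) with (y := eps) as [N HN].
  { rewrite Rabs_pos_eq; lra. }
  { easy. }
  specialize (HN N (le_n _)). rewrite Rabs_pos_eq in HN by (apply pow_le; lra).
  destruct (Main N) as [t [Ht [Pt _]]]. exists t. split; [lra|easy].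
Qed.

Lemma irrational_multiples (c : C) :
  Im c = 0 -> ~ rational c -> forall m n : Z, n <> 0%Z -> IZR n * Re c <> IZR m.
Proof.
  intros Hi Hr m n Hn E. apply Hr. exists (inject_Z m / inject_Z n)%Q.
  assert (IZR n <> 0) by now apply not_0_IZR.
  rewrite Q2R_div.
  - unfold Q2R; simpl. rewrite Rinv_1, !Rmult_1_r, <- E.
    destruct c as [a b]; simpl in *. rewrite Hi. unfold RtoC. f_equal. field. easy.
  - intros H0. apply Hn. unfold Qeq in H0; simpl in H0. lia.
Qed.

(** The map [lin] carries the unit square onto a period parallelogram of the lattice spanned by 1
    and c; s and t are the coordinates of w in that basis, reduced modulo 1. *)
Lemma max_of_doubly_periodic (q : C -> R) (c : C) :
  Im c <> 0 -> (forall w, continuous_at (fun w => RtoC (q w)) w) ->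
  (forall w, q (w + 1)%C = q w) -> (forall w, q (w + c)%C = q w) ->
  exists w1, forall w, q w <= q w1.
Proof.
  intros Hc Hq H1 H2.
  set (lin := fun w : C => (RtoC (Re w) + RtoC (Im w) * c)%C).
  destruct (max_on_square (fun w => q (lin w)) 0 0 1) as [p [Hp Hmax]]; [lra| |].
  { intros w _. apply (continuous_at_comp lin (fun w => RtoC (q w))); [|apply Hq].
    apply continuous_at_plus; [apply continuous_at_Re|].
    apply continuous_at_mult; [apply continuous_at_Im|apply continuous_at_const]. }
  exists (lin p). intros w.
  set (t := Im w / Im c). set (s := Re w - t * Re c).
  destruct (floor_exists s) as [m Hm]. destruct (floor_exists t) as [n Hn].
  rewrite <- (periodic_IZR q 1 H1 (- m)), <- (periodic_IZR q c H2 (- n)).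
  match goal with |- q ?a <= _ => replace a with (lin (s - IZR m, t - IZR n)) end.
  - apply Hmax. split; simpl; lra.
  - unfold lin, Re, Im; simpl. rewrite !opp_IZR.
    destruct w as [w1 w2], c as [c1 c2]. unfold s, t, Re, Im in *; simpl in *.
    unfold Cplus, Cmult, RtoC; simpl. f_equal; field; easy.
Qed.

(* The perturbation eps / |w - p|^2 is strictly subharmonic: with Y = (w0 - p) / (w - p),
   |Y|^2 = 1 + 2 Re (Y - 1) + |Y - 1|^2, so a maximum of q + eps / |w - p|^2 at w0 becomes
   a strict maximum of q plus the real part of a holomorphic function. *)
Lemma perturbed_strict_max (q : C -> R) (w1 p : C) :
  (forall w, continuous_at (fun w => RtoC (q w)) w) ->
  (forall w, q w <= q w1) -> q p < q w1 ->
  exists (w0 : C) (kappa rho : R), 0 < rho /\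
    forall w, Cmod (w - w0)%C < rho -> w <> p /\
      (w <> w0 -> q w + kappa * Re ((w0 - p) / (w - p)) < q w0 + kappa).
Proof.
  intros Hq Hmax Hp. set (M := q w1) in *. set (eta := (M - q p) / 2).
  assert (He : 0 < eta) by (unfold eta; lra).
  destruct (Hq p eta He) as [d [Hd Hdp]].
  set (del := d / 2). assert (Hdel : 0 < del) by (unfold del; lra).
  assert (Hnear : forall w, Cmod (w - p)%C < 2 * del -> q w < M - eta).
  { intros w Hw. specialize (Hdp w ltac:(unfold del in Hw; lra)).
    rewrite RtoC_Cmod_minus in Hdp. apply Rabs_def2 in Hdp. unfold eta in *. lra. }
  (* The perturbation is then at most eps / del^2 = eta / 2, too little to lift the values near p,
     which are below M - eta, up to M. *)
  set (eps := eta * (del * del) / 2).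
  assert (Hdd : 0 < del * del) by (apply Rmult_lt_0_compat; lra).
  assert (Heps : 0 < eps) by (apply Rdiv_lt_0_compat; [apply Rmult_lt_0_compat|]; lra).
  (* Truncation makes 1 / |w - p|^2 continuous at p too; at distance at least del from p nothing
     changes. *)
  set (v := fun w => / Rmax (del * del) (Cmod (w - p)%C * Cmod (w - p)%C)).
  assert (Dpos : forall w, 0 < Rmax (del * del) (Cmod (w - p)%C * Cmod (w - p)%C)).
  { intros w. eapply Rlt_le_trans; [|apply Rmax_l]. nra. }
  assert (Vpos : forall w, 0 < v w) by (intros; now apply Rinv_0_lt_compat).
  assert (Vfar : forall w, del <= Cmod (w - p)%C -> v w = / (Cmod (w - p)%C * Cmod (w - p)%C)).
  { intros w Hw. unfold v. rewrite Rmax_right; nra. }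
  assert (Vup : forall w, v w <= / (del * del)).
  { intros w. apply Rinv_le_contravar; [nra|apply Rmax_l]. }
  assert (Evp : eps * / (del * del) = eta / 2) by (unfold eps; field; lra).
  set (s := fun w => q w + eps * v w).
  assert (Cs : forall w, continuous_at (fun w => RtoC (s w)) w).
  { intros w0. apply (continuous_at_local (fun w => (RtoC (q w) + RtoC eps *
      / RtoC (Rmax (del * del) (Cmod (w - p)%C * Cmod (w - p)%C)))%C) _ w0 1); [lra| |].
    - intros w _. unfold s, v. rewrite RtoC_plus, RtoC_mult, RtoC_inv; [easy|].
      specialize (Dpos w). lra.
    - apply continuous_at_plus; [apply Hq|].
      apply continuous_at_mult; [apply continuous_at_const|].
      apply (continuous_at_inv (fun w => RtoC (Rmax (del * del) (Cmod (w - p)%C * Cmod (w - p)%C)))).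
      + assert (Cm : continuous_at (fun w => RtoC (Cmod (w - p)%C * Cmod (w - p)%C)) w0).
        { apply (continuous_at_local (fun w => (RtoC (Cmod (w - p)%C) * RtoC (Cmod (w - p)%C))%C)
            _ w0 1); [lra|intros; now rewrite RtoC_mult|].
          assert (continuous_at (fun w => RtoC (Cmod (w - p)%C)) w0).
          { apply (continuous_at_comp (fun w => (w - p)%C) (fun w => RtoC (Cmod w)));
              [|apply continuous_at_Cmod].
            apply continuous_at_minus; [apply continuous_at_id|apply continuous_at_const]. }
          now apply continuous_at_mult. }
        intros e Hpe. destruct (Cm e Hpe) as [d' [Hd' H']]. exists d'. split; [easy|].
        intros w Hw. specialize (H' w Hw). rewrite RtoC_Cmod_minus in *.
        eapply Rle_lt_trans; [|exact H'].
        set (A := Cmod (w - p)%C * Cmod (w - p)%C). set (B := Cmod (w0 - p)%C * Cmod (w0 - p)%C).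
        clearbody A B. clear. set (D := del * del). clearbody D.
        unfold Rmax. destruct (Rle_dec D A), (Rle_dec D B); unfold Rabs;
          repeat destruct Rcase_abs; lra.
      + specialize (Dpos w0). intros E. apply RtoC_inj in E. lra. }
  set (R0 := Cmod (w1 - p)%C + 1).
  pose proof (Cmod_ge_0 (w1 - p)%C) as P1.
  assert (HR0 : 0 < R0) by (unfold R0; lra).
  destruct (max_on_square s (Re p - R0) (Im p - R0) (2 * R0)) as [w0 [Hw0 Hm]]; [lra|intros; apply Cs|].
  assert (F1 : 2 * del <= Cmod (w1 - p)%C).
  { apply Rnot_lt_le. intros H. specialize (Hnear w1 H). fold M in Hnear. lra. }
  assert (S1 : s w1 <= s w0).
  { apply Hm. pose proof (re_le_Cmod (w1 - p)%C) as A1. pose proof (Im_le_Cmod (w1 - p)%C) as A2.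
    unfold Cminus in A1 at 1. unfold Cminus in A2 at 1.
    rewrite re_plus, re_opp in A1. rewrite im_plus, im_opp in A2.
    apply Rabs_le_between in A1, A2. unfold R0. split; lra. }
  assert (Es1 : s w1 = M + eps * v w1) by reflexivity.
  assert (Es0 : s w0 = q w0 + eps * v w0) by reflexivity.
  assert (F0 : 2 * del <= Cmod (w0 - p)%C).
  { apply Rnot_lt_le. intros H. specialize (Hnear w0 H). pose proof (Vup w0). pose proof (Vpos w1).
    assert (eps * v w0 <= eps * / (del * del)) by (apply Rmult_le_compat_l; lra).
    assert (0 < eps * v w1) by (apply Rmult_lt_0_compat; lra). lra. }
  (* As q is largest at w1, the point w0 can only compete by being no farther from p. With the
     margin 1 in [R0], the unit ball around w0 stays in the square, so w0 is a local maximum. *)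
  assert (I0 : Cmod (w0 - p)%C <= Cmod (w1 - p)%C).
  { apply Rnot_lt_le. intros H. specialize (Hmax w0).
    assert (V01 : v w0 < v w1).
    { rewrite !Vfar by lra. apply Rinv_lt_contravar; [|nra].
      repeat apply Rmult_lt_0_compat; lra. }
    apply (Rmult_lt_compat_l eps) in V01; lra. }
  set (u0 := Cmod (w0 - p)%C) in *.
  (* This kappa is the coefficient of Re (Y - 1) in eps |Y|^2 / u0^2; the leftover eps |Y - 1|^2 /
     u0^2 makes the inequality strict. The radius del avoids the truncation, the radius 1 stays in
     the square. *)
  exists w0, (2 * eps * / (u0 * u0)), (Rmin del 1). split; [apply Rmin_pos; lra|].
  intros w Hw. apply Rmin_Rgt_l in Hw as [Hwd Hw1].
  assert (Fw : del < Cmod (w - p)%C).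
  { pose proof (Cmod_sub_triangle w0 w p). rewrite (Cmod_sub_sym w0 w) in H. fold u0 in H. lra. }
  assert (Nw : (w - p)%C <> RtoC 0) by (apply Cmod_gt_0; lra).
  split; [intros ->; apply Nw; ring|].
  intros Nw0.
  assert (Sw : s w <= s w0).
  { apply Hm. pose proof (Cmod_sub_triangle w w0 p) as T. fold u0 in T.
    pose proof (re_le_Cmod (w - p)%C) as A1. pose proof (Im_le_Cmod (w - p)%C) as A2.
    unfold Cminus in A1 at 1. unfold Cminus in A2 at 1.
    rewrite re_plus, re_opp in A1. rewrite im_plus, im_opp in A2.
    apply Rabs_le_between in A1, A2. unfold R0. split; lra. }
  unfold s in Sw. rewrite (Vfar w), (Vfar w0) in Sw by (fold u0; lra). fold u0 in Sw.
  set (Y := ((w0 - p) / (w - p))%C).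
  assert (EY : Cmod Y = u0 / Cmod (w - p)%C) by (unfold Y; now rewrite Cmod_div).
  assert (Y1 : 0 < Cmod (Y - 1)%C).
  { apply Cmod_gt_0. intros E. apply Ceq_minus in E. apply Nw0. unfold Y in E.
    apply Ceq_minus. replace (w - w0)%C with ((w - p) * (1 - (w0 - p) / (w - p)))%C by (field; easy).
    rewrite E. ring. }
  assert (E2 : Cmod Y ^ 2 = 1 + 2 * (Re Y - 1) + Cmod (Y - 1)%C ^ 2).
  { rewrite !Cmod2_alt. unfold Cminus. rewrite re_plus, re_opp, re_RtoC, im_plus, im_opp, im_RtoC.
    ring. }
  assert (E3 : / (Cmod (w - p)%C * Cmod (w - p)%C) = Cmod Y ^ 2 * / (u0 * u0)).
  { rewrite EY. field. split; lra. }
  rewrite E3, E2 in Sw.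
  assert (0 < eps * / (u0 * u0)) by (apply Rmult_lt_0_compat; [easy|apply Rinv_0_lt_compat; nra]).
  assert (0 < Cmod (Y - 1)%C ^ 2) by nra.
  nra.
Qed.

(** * Functions on the plane factoring through the Koenigs function *)

(* f = F o g up to integer translates of g; F is not assumed to be differentiable
   because g' might vanish as far as we know. *)
Record factors_through (V : C -> Prop) (g f F : C -> C) : Prop := {
  factor_open : forall z, V z -> exists r, 0 < r /\ forall w, Cmod (w - z)%C < r -> V w;
  factor_inner_diff : forall z, V z -> differentiable_at g z;
  factor_diff : forall z, V z -> differentiable_at f z;
  factor_inj : injective_on V g;
  factor_cover : forall w, exists (n : nat) (z : C), V z /\ w = (g z - INR n)%C;
  factor_eq : forall (z : C) (n : nat), V z -> F (g z - INR n)%C = f z }.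

(** Injectivity on V isolates every value of g, which is all that the open mapping argument asks
    for. *)
Lemma factor_inner_open (V : C -> Prop) (g f F : C -> C) (z0 : C) (r : R) :
  factors_through V g f F -> V z0 -> 0 < r ->
  exists eta, 0 < eta /\ forall w, Cmod (w - g z0)%C < eta ->
    exists z, V z /\ Cmod (z - z0)%C < r /\ g z = w.
Proof.
  intros HF Hz0 Hr. destruct (factor_open _ _ _ _ HF z0 Hz0) as [s [Hs HV]].
  assert (Hm : 0 < Rmin r s) by now apply Rmin_pos.
  destruct (open_at_isolated_value g z0 (Rmin r s) Hm) as [eta [He H]].
  - intros z Hz. apply Rmin_Rgt_l in Hz as [_ Hz]. now apply (factor_inner_diff _ _ _ _ HF), HV.
  - intros z Hz Nz E. apply Rmin_Rgt_l in Hz as [_ Hz]. apply Nz.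
    apply (factor_inj _ _ _ _ HF); auto.
  - exists eta. split; [easy|]. intros w Hw. destruct (H w Hw) as [z [Hz Ez]].
    apply Rmin_Rgt_l in Hz as [Hz1 Hz2]. exists z. auto.
Qed.

(** Openness of g lifts points near w to points near a preimage, where f varies little. *)
Lemma factor_continuous (V : C -> Prop) (g f F : C -> C) (w : C) :
  factors_through V g f F -> continuous_at F w.
Proof.
  intros HF eps He. destruct (factor_cover _ _ _ _ HF w) as [n [z0 [Hz0 ->]]].
  destruct (differentiable_at_continuous f z0 (factor_diff _ _ _ _ HF z0 Hz0) eps He)
    as [r [Hr Hfr]].
  destruct (factor_inner_open V g f F z0 r HF Hz0 Hr) as [eta [Heta H]].
  exists eta. split; [easy|]. intros w Hw.
  destruct (H (w + INR n)%C) as [z [Hz [Hzr Ez]]].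
  - now replace (w + INR n - g z0)%C with (w - (g z0 - INR n))%C by ring.
  - rewrite (factor_eq _ _ _ _ HF z0 n Hz0).
    replace w with (g z - INR n)%C by (rewrite Ez; ring).
    rewrite (factor_eq _ _ _ _ HF z n Hz). auto.
Qed.

(** The index n is free: if w + 1 = g z - n, then w = g z - (n + 1), and both have the value f z. *)
Lemma factor_periodic (V : C -> Prop) (g f F : C -> C) (w : C) :
  factors_through V g f F -> F (w + 1)%C = F w.
Proof.
  intros HF. destruct (factor_cover _ _ _ _ HF (w + 1)%C) as [n [z [Hz E]]].
  rewrite E, (factor_eq _ _ _ _ HF z n Hz), <- (factor_eq _ _ _ _ HF z (S n) Hz).
  f_equal. rewrite S_INR, RtoC_plus.
  replace w with (w + 1 - 1)%C by ring. rewrite E. ring.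
Qed.

Lemma quasi_period_zero (F : C -> C) (c d : C) :
  (forall w, continuous_at F w) -> (forall w, F (w + 1)%C = F w) ->
  Im c = 0 -> (forall w, F (w + c)%C = (F w + d)%C) -> d = RtoC 0.
Proof.
  intros Fc F1 Hc Fd.
  destruct (max_on_square (fun w => Cmod (F w)) 0 0 1) as [p [_ Hp]]; [lra| |].
  { intros w _. apply (continuous_at_comp F (fun w => RtoC (Cmod w))); [apply Fc|].
    apply continuous_at_Cmod. }
  set (B := Cmod (F p)) in *.
  assert (Hn : forall n : nat, F (INR n * c)%C = (F 0 + INR n * d)%C).
  { induction n as [|n IH].
    - simpl. rewrite !Cmult_0_l. ring.
    - replace (INR (S n) * c)%C with (INR n * c + c)%C by (rewrite S_INR, RtoC_plus; ring).
      rewrite Fd, IH, S_INR, RtoC_plus. ring. }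
  assert (Hb : forall n : nat, INR n * Cmod d <= B + Cmod (F 0%C)).
  { intros n. destruct (floor_exists (INR n * Re c)) as [m Hm].
    assert (E : Cmod (F (INR n * c)%C) <= B).
    { rewrite <- (periodic_IZR F 1 F1 (- m)). apply Hp.
      rewrite opp_IZR. destruct c as [a b]; unfold Re, Im in *; simpl in *.
      split; simpl; [|rewrite Hc]; lra. }
    replace (INR n * Cmod d) with (Cmod (INR n * d)%C)
      by (rewrite Cmod_mult, Cmod_R, Rabs_pos_eq; [easy|apply pos_INR]).
    replace (INR n * d)%C with (F (INR n * c)%C - F 0%C)%C by (rewrite Hn; ring).
    eapply Rle_trans; [apply Cmod_triangle|]. rewrite Cmod_opp. lra. }
  destruct (Ceq_dec d 0) as [E|E]; [easy|]. apply Cmod_gt_0 in E.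
  destruct (archimed ((B + Cmod (F 0%C)) / Cmod d)) as [Ha _].
  set (k := up ((B + Cmod (F 0%C)) / Cmod d)) in *.
  assert (Bp : 0 <= B) by apply Cmod_ge_0. pose proof (Cmod_ge_0 (F 0%C)) as Fp.
  assert (Q : 0 <= (B + Cmod (F 0%C)) / Cmod d) by (apply Rdiv_le_0_compat; lra).
  assert (K : (0 <= k)%Z) by (apply le_IZR; lra).
  specialize (Hb (Z.to_nat k)). rewrite INR_IZR_INZ, Z2Nat.id in Hb by easy.
  apply (Rmult_lt_compat_r (Cmod d)) in Ha; [|easy].
  replace ((B + Cmod (F 0%C)) / Cmod d * Cmod d) with (B + Cmod (F 0%C)) in Ha by (field; lra).
  lra.
Qed.

(** Openness of g turns a small period t into a point z' near z with g z' = g z + t, so z' differs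
    from z while f z' = f z; the first-order expansion then gives |d| <= eps. *)
Lemma derivative_zero_of_small_periods (V : C -> Prop) (g f F : C -> C) (z : C) :
  factors_through V g f F ->
  (forall eps, 0 < eps -> exists t, 0 < t < eps /\ forall w, F (w + RtoC t)%C = F w) ->
  V z -> derivative_at f z 0.
Proof.
  intros HF Ht Hz. destruct (factor_diff _ _ _ _ HF z Hz) as [d Hd].
  replace (RtoC 0) with d; [easy|].
  apply Cmod_eq_0. apply Rle_antisym; [|apply Cmod_ge_0].
  apply le_epsilon. intros eps He. rewrite Rplus_0_l.
  destruct (derivative_at_approx f z d eps Hd He) as [s [Hs H]].
  destruct (factor_inner_open V g f F z s HF Hz Hs) as [eta [Heta Ho]].
  destruct (Ht eta Heta) as [t [Htt Pt]].
  destruct (Ho (g z + RtoC t)%C) as [z' [Hz' [Dz' Ez']]].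
  { replace (g z + RtoC t - g z)%C with (RtoC t) by ring. rewrite Cmod_R, Rabs_pos_eq; lra. }
  assert (Ef : f z' = f z).
  { rewrite <- (factor_eq _ _ _ _ HF z' 0 Hz'), <- (factor_eq _ _ _ _ HF z 0 Hz), Ez'.
    rewrite <- (Pt (g z - INR 0)%C). f_equal. ring. }
  assert (Nz : (z' - z)%C <> RtoC 0).
  { intros E. apply Ceq_minus in E. subst z'.
    assert (E : RtoC t = RtoC 0).
    { replace (RtoC t) with (g z + RtoC t - g z)%C by ring. rewrite <- Ez' at 1. ring. }
    apply RtoC_inj in E. lra. }
  specialize (H z' Dz'). rewrite Ef in H.
  replace (f z - f z - d * (z' - z))%C with (- (d * (z' - z)))%C in H by ring.
  rewrite Cmod_opp, Cmod_mult in H. apply Cmod_gt_0 in Nz.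
  now apply Rmult_le_reg_r in H.
Qed.

Lemma Re_constant_of_quasi_periods (V : C -> Prop) (g f F : C -> C) (c d : C) :
  factors_through V g f F -> Im c <> 0 -> (forall w, F (w + c)%C = (F w + d)%C) ->
  exists mu M, forall w, Re (F w - mu * Ci * w)%C = M.
Proof.
  (* Along c, Re F gains Re d and mu Im w gains mu Im c; this mu makes the gains cancel. *)
  intros HF Hc Fd. set (mu := - Re d / Im c).
  set (q := fun w => Re (F w - RtoC mu * Ci * w)%C).
  assert (Qc : forall w, continuous_at (fun w => RtoC (q w)) w).
  { intros w. apply (continuous_at_comp (fun w => (F w - RtoC mu * Ci * w)%C) (fun w => RtoC (Re w)));
      [|apply continuous_at_Re].
    apply continuous_at_minus; [now apply (factor_continuous V g f)|].
    apply continuous_at_mult; [apply continuous_at_const|apply continuous_at_id]. }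
  assert (Eq : forall w, q w = Re (F w) + mu * Im w).
  { intros w. unfold q, Cminus. rewrite re_plus, re_opp. f_equal.
    destruct w as [a b]. unfold Ci, RtoC, Cmult, Re, Im; simpl. ring. }
  assert (Q1 : forall w, q (w + 1)%C = q w).
  { intros w. rewrite !Eq, (factor_periodic V g f F w HF), im_plus, im_RtoC. ring. }
  assert (Q2 : forall w, q (w + c)%C = q w).
  { intros w. rewrite !Eq, Fd, im_plus, re_plus. unfold mu. field. easy. }
  destruct (max_of_doubly_periodic q c Hc Qc Q1 Q2) as [w1 Hmax].
  exists (RtoC mu), (q w1). intros p. change (q p = q w1).
  destruct (Req_dec (q p) (q w1)) as [E|E]; [easy|exfalso].
  specialize (Hmax p) as Hp.
  destruct (perturbed_strict_max q w1 p Qc Hmax) as [w0 [kappa [rho [Hrho Hs]]]]; [lra|].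
  destruct (factor_cover _ _ _ _ HF w0) as [n [z0 [Hz0 Ew0]]].
  destruct (factor_open _ _ _ _ HF z0 Hz0) as [r [Hr HV]].
  destruct (differentiable_at_continuous g z0 (factor_inner_diff _ _ _ _ HF z0 Hz0) rho Hrho)
    as [s [Hsp Hg]].
  assert (Hball : forall z, Cmod (z - z0)%C < Rmin r s ->
    V z /\ Cmod (g z - INR n - w0)%C < rho).
  { intros z Hz. apply Rmin_Rgt_l in Hz as [Hz1 Hz2]. split; [auto|].
    rewrite Ew0. replace (g z - INR n - (g z0 - INR n))%C with (g z - g z0)%C by ring. auto. }
  (* The perturbed function pulled back by w = g z - n. It is holomorphic near z0, and injectivity
     of g keeps the maximum of its real part strict. *)
  set (k := fun z => ((f z - RtoC mu * Ci * (g z - INR n))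
    + RtoC kappa * ((w0 - p) * / (g z - INR n - p)))%C).
  assert (Ek : forall z, V z ->
    Re (k z) = q (g z - INR n)%C + kappa * Re ((w0 - p) / (g z - INR n - p))).
  { intros z Hz. unfold k, q. rewrite re_plus, re_scal_l, (factor_eq _ _ _ _ HF z n Hz).
    reflexivity. }
  apply (strict_local_max_Re_absurd k z0 (Rmin r s)).
  - now apply Rmin_pos.
  - intros z Hz. destruct (Hball z Hz) as [Vz Bz]. destruct (Hs _ Bz) as [Np _].
    assert (Dg : differentiable_at (fun z => (g z - INR n)%C) z).
    { apply differentiable_at_minus; [now apply (factor_inner_diff _ _ _ _ HF)|].
      apply differentiable_at_const. }
    apply differentiable_at_plus.
    + apply differentiable_at_minus; [now apply (factor_diff _ _ _ _ HF)|].
      apply differentiable_at_mult; [apply differentiable_at_const|easy].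
    + apply differentiable_at_mult; [apply differentiable_at_const|].
      apply differentiable_at_mult; [apply differentiable_at_const|].
      apply (differentiable_at_inv (fun z => (g z - INR n - p)%C)).
      * apply differentiable_at_minus; [easy|apply differentiable_at_const].
      * now apply Cminus_eq_contra.
  - intros z Hz Nz. destruct (Hball z Hz) as [Vz Bz]. destruct (Hs _ Bz) as [_ Hlt].
    destruct (Hs w0) as [N0 _]; [now rewrite Cmod_sub_diag|].
    rewrite (Ek z Vz), (Ek z0 Hz0), <- Ew0.
    replace ((w0 - p) / (w0 - p))%C with (RtoC 1)
      by (field; now apply Cminus_eq_contra).
    rewrite re_RtoC, Rmult_1_r. apply Hlt. intros Ew. apply Nz.
    apply (factor_inj _ _ _ _ HF); [easy|easy|].
    replace (g z) with (g z - INR n + INR n)%C by ring. rewrite Ew, Ew0. ring.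
Qed.

(** * Descent of invariant functions from the disc to the plane *)

Lemma unit_disc_open (z : C) :
  unit_disc z -> exists r, 0 < r /\ forall w, Cmod (w - z)%C < r -> unit_disc w.
Proof.
  unfold unit_disc. intros Hz. exists (1 - Cmod z). split; [lra|]. intros w Hw.
  pose proof (Cmod_le_sub w z). lra.
Qed.

Lemma open_ball (V : C -> Prop) (z : C) :
  open V -> V z -> exists r, 0 < r /\ forall w, Cmod (w - z)%C < r -> V w.
Proof.
  intros HV Hz. destruct (proj1 (locally_C z V) (HV z Hz)) as [r Hr].
  exists r. split; [apply cond_pos|]. intros w Hw. apply Hr. exact Hw.
Qed.

Lemma iterate_unit_disc (phi : C -> C) (n : nat) (z : C) :
  (forall w, unit_disc w -> unit_disc (phi w)) -> unit_disc z -> unit_disc (iterate phi n z).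
Proof. intros H Hz. induction n; [easy|]. now apply H. Qed.

(** F w is the value of f at a chosen z with w = g z - n; the covering property supplies z, and
    invariance of f makes the choice irrelevant. *)
Lemma koenigs_factor (phi g f : C -> C) :
  (forall z, unit_disc z -> unit_disc (phi z)) ->
  koenigs_function phi g -> (forall z, unit_disc z -> differentiable_at f z) ->
  (forall z, unit_disc z -> f (phi z) = f z) ->
  exists (V : C -> Prop) (F : C -> C), absorbing_domain phi V /\ factors_through V g f F /\
    forall (z : C) (n : nat), unit_disc z -> F (g z - INR n)%C = f z.
Proof.
  intros Hphi [Hg [_ [gphi [gcover [V [HV Vinj]]]]]] Hf fphi.
  pose proof HV as [[Vopen _] [Vdisc [Vphi Vabs]]].
  assert (gn : forall n z, unit_disc z -> g (iterate phi n z) = (g z + INR n)%C).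
  { induction n as [|n IH]; intros z Hz; [simpl; ring|].
    change (iterate phi (S n) z) with (phi (iterate phi n z)).
    rewrite gphi, IH, S_INR, RtoC_plus by (try apply iterate_unit_disc; easy). ring. }
  assert (fn : forall n z, unit_disc z -> f (iterate phi n z) = f z).
  { induction n as [|n IH]; intros z Hz; [easy|].
    change (iterate phi (S n) z) with (phi (iterate phi n z)).
    now rewrite fphi, IH by (try apply iterate_unit_disc; easy). }
  assert (Vn : forall n z, V z -> V (iterate phi n z)).
  { induction n; intros z Hz; [easy|]. now apply Vphi, IHn. }
  assert (WD : forall z z' n n', unit_disc z -> unit_disc z' ->
    (g z - INR n)%C = (g z' - INR n')%C -> f z = f z').
  { intros z z' n n' Hz Hz' E.
    destruct (Vabs z Hz) as [N HN]. destruct (Vabs z' Hz') as [N' HN'].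
    set (z1 := iterate phi N z) in *. set (z1' := iterate phi N' z') in *.
    (* The extra iterations make both values of g equal to g z + N + N' + n' = g z' + N + N' + n.
       Both points lie in V, so the two orbits merge. *)
    assert (Eit : iterate phi (N' + n') z1 = iterate phi (N + n) z1').
    { apply Vinj; [now apply Vn|now apply Vn|].
      rewrite !gn by now apply Vdisc. unfold z1, z1'. rewrite !gn by easy.
      rewrite !plus_INR, !RtoC_plus.
      replace (g z) with (g z - INR n + INR n)%C by ring. rewrite E. ring. }
    rewrite <- (fn N z Hz), <- (fn N' z' Hz'). fold z1 z1'.
    rewrite <- (fn (N' + n')%nat z1), <- (fn (N + n)%nat z1') by now apply Vdisc.
    now rewrite Eit. }
  destruct (choice (fun w z => unit_disc z /\ exists n : nat, w = (g z - INR n)%C))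
    as [lift Hlift].
  { intros w. destruct (gcover w) as [n [z [Hz E]]]. exists z. eauto. }
  exists V, (fun w => f (lift w)).
  assert (FD : forall (z : C) (n : nat), unit_disc z -> f (lift (g z - INR n)%C) = f z).
  { intros z n Hz. destruct (Hlift (g z - INR n)%C) as [Hl [n' E]].
    symmetry. now apply (WD z _ n n'). }
  split; [easy|]. split; [|easy]. constructor.
  - intros z Hz. now apply open_ball.
  - intros z Hz. now apply differentiable_at_of_ex_derive, Hg, Vdisc.
  - intros z Hz. now apply Hf, Vdisc.
  - easy.
  - intros w. destruct (gcover w) as [n [z [Hz E]]]. destruct (Vabs z Hz) as [N HN].
    exists (n + N)%nat, (iterate phi N z). split; [easy|].
    rewrite gn, plus_INR, RtoC_plus, E by easy. ring.
  - intros z n Hz. now apply FD, Vdisc.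
Qed.

(** Since f = f o phi, a zero derivative at phi z gives one at z by the chain rule; every orbit
    reaches V after finitely many such steps. *)
Lemma derivative_zero_of_absorbing (phi f : C -> C) (V : C -> Prop) :
  holomorphic_self_map phi -> absorbing_domain phi V ->
  (forall z, unit_disc z -> f (phi z) = f z) ->
  (forall z, V z -> derivative_at f z 0) ->
  forall z, unit_disc z -> derivative_at f z 0.
Proof.
  intros [Hphi Dphi] [_ [_ [_ Vabs]]] fphi HV z Hz.
  destruct (Vabs z Hz) as [n Hn]. revert z Hz Hn.
  induction n as [|n IH]; intros z Hz Hn; [now apply HV|].
  destruct (differentiable_at_of_ex_derive phi z (Hphi z Hz)) as [a Ha].
  destruct (unit_disc_open z Hz) as [r [Hr Hball]].
  apply (derivative_at_local (fun w => f (phi w)) f z 0 r Hr); [auto|].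
  replace (RtoC 0) with (0 * a)%C by ring. apply derivative_at_comp; [easy|].
  apply IH; [now apply Dphi|].
  unfold iterate in *. now rewrite Nat.iter_swap.
Qed.

Theorem proposition5p2 (phi psi hphi h : C -> C) (c c1 c2 : C)
  (phi_parabolic : parabolic phi)
  (phi_step : zero_hyperbolic_step phi)
  (hphi_koenigs : koenigs_function phi hphi)
  (psi_centralizer : centralizer phi psi)
  (c_coefficient : linearization_coefficient hphi psi c)
  (h_holomorphic : holomorphic_on unit_disc h)
  (h_phi : forall z : C, unit_disc z -> h (phi z) = (h z + c1)%C)
  (h_psi : forall z : C, unit_disc z -> h (psi z) = (h z + c2)%C)
  (c12_neq0 : Cmod c1 ^ 2 + Cmod c2 ^ 2 <> 0)
  (c_irrational : ~ rational c) :
  forall z : C, unit_disc z -> (h z - h 0)%C = (c1 * hphi z)%C.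
Proof.
  destruct phi_parabolic as [phi_self _]. pose proof phi_self as [_ phi_disc].
  destruct psi_centralizer as [[_ psi_disc] _].
  pose proof hphi_koenigs as [g_hol [g0 [g_phi [g_cover _]]]].
  set (f := fun z => (h z - c1 * hphi z)%C). set (d := (c2 - c1 * c)%C).
  assert (f_diff : forall z, unit_disc z -> differentiable_at f z).
  { intros z Hz. apply differentiable_at_minus; [now apply differentiable_at_of_ex_derive, h_holomorphic|].
    apply differentiable_at_mult; [apply differentiable_at_const|].
    now apply differentiable_at_of_ex_derive, g_hol. }
  assert (f_phi : forall z, unit_disc z -> f (phi z) = f z).
  { intros z Hz. unfold f. rewrite h_phi, g_phi by easy. ring. }
  assert (g_psi : forall z, unit_disc z -> hphi (psi z) = (hphi z + c)%C).
  { intros z Hz. rewrite <- (c_coefficient z Hz). ring. }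
  assert (f_psi : forall z, unit_disc z -> f (psi z) = (f z + d)%C).
  { intros z Hz. unfold f, d. rewrite h_psi, g_psi by easy. ring. }
  destruct (koenigs_factor phi hphi f) as [V [F [V_abs [HF F_eq]]]]; try easy.
  (* For w = g z - n, the point w + c is g (psi z) - n, so the relation is that of f under psi. *)
  assert (F_c : forall w, F (w + c)%C = (F w + d)%C).
  { intros w. destruct (g_cover w) as [n [z [Hz ->]]].
    rewrite F_eq, <- f_psi, <- (F_eq _ n), g_psi by auto. f_equal. ring. }
  assert (F_0 : forall z, unit_disc z -> F (hphi z) = f z).
  { intros z Hz. rewrite <- (F_eq z 0%nat Hz). f_equal. simpl. ring. }
  assert (D0 : unit_disc 0%C) by (unfold unit_disc; rewrite Cmod_0; lra).
  assert (f_const : forall z, unit_disc z -> f z = f 0%C).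
  { destruct (Req_dec (Im c) 0) as [c_real|c_nonreal].
    - apply derivative_zero_on_disc.
      (* Injectivity of [hphi], on which the small-period argument rests, is given on V; the
         conclusion is carried to the disc along phi. *)
      apply (derivative_zero_of_absorbing phi f V); try easy.
      intros z Hz. apply (derivative_zero_of_small_periods V hphi f F); try easy.
      assert (d0 : d = RtoC 0).
      { apply (quasi_period_zero F c); try easy; intros w.
        - now apply (factor_continuous V hphi f).
        - now apply (factor_periodic V hphi f). }
      apply (small_elements_of_subgroup (fun t => forall w, F (w + RtoC t)%C = F w) (Re c)).
      + intros w. now apply (factor_periodic V hphi f).
      + intros w. replace (RtoC (Re c)) with c.
        * rewrite F_c, d0. ring.
        * destruct c as [a b]. unfold RtoC; simpl in *. now f_equal.
      + intros s t Hs Ht w. rewrite <- (Ht (w + RtoC (s - t))%C), <- (Hs w).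
        f_equal. rewrite RtoC_minus. ring.
      + now apply irrational_multiples.
    - destruct (Re_constant_of_quasi_periods V hphi f F c d HF c_nonreal F_c) as [mu [M HM]].
      set (k := fun z => (f z - mu * Ci * hphi z)%C).
      (* The identity [F_0] holds on the whole disc, so Re k is constant there and no transfer from
         V is needed. *)
      assert (k_const : forall z, unit_disc z -> k z = k 0%C).
      { apply derivative_zero_on_disc. intros z Hz.
        destruct (unit_disc_open z Hz) as [r [Hr Hball]].
        apply (derivative_zero_of_constant_Re k z M r Hr).
        - apply differentiable_at_minus; [now apply f_diff|].
          apply differentiable_at_mult; [apply differentiable_at_const|].
          now apply differentiable_at_of_ex_derive, g_hol.
        - intros w Hw. rewrite <- (HM (hphi w)), F_0 by auto. easy. }
      assert (mu0 : (mu * Ci)%C = RtoC 0).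
      { pose proof (k_const (phi 0%C) (phi_disc _ D0)) as E. unfold k in E.
        rewrite f_phi, g_phi in E by easy.
        replace (mu * Ci)%C with ((f 0 - mu * Ci * hphi 0)
          - (f 0 - mu * Ci * (hphi 0 + 1)))%C by ring. rewrite E. ring. }
      intros z Hz. specialize (k_const z Hz). unfold k in k_const. rewrite mu0 in k_const.
      now rewrite !Cmult_0_l in k_const; unfold Cminus in k_const;
        rewrite !Copp_0, !Cplus_0_r in k_const. }
  intros z Hz. specialize (f_const z Hz). unfold f in f_const. rewrite g0 in f_const.
  replace (h z) with (h z - c1 * hphi z + c1 * hphi z)%C by ring. rewrite f_const. ring.
Qed.
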